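(* Let $n\ge 1$. As maps on the set $\mathrm{NC}(n)$ of non-crossing partitions of $[n]$, $$\mathrm{Kre}\sim\partial,\qquad \mathrm{Rot}=\mathrm{Kre}^2\sim\partial^2,\qquad \mathrm{SU}\sim \mathrm{ev}\circ\partial,\qquad \mathrm{LK}\sim\mathrm{ev}\circ\partial^{-1},$$ where $X\sim Y$ (for $X$ a map on $\mathrm{NC}(n)$ and $Y$ a map on Dyck paths of size $n$) means $X=\theta^{-1}\circ Y\circ\theta$, with $\theta$ the bijection from $\mathrm{NC}(n)$ to Dyck paths of size $n$ (denoted $\mathrm{NCPtoDyck}$) described in the context.
   Context: Dyck paths. A Dyck path of size $n$ is a lattice path from $(0,0)$ to $(n,n)$ with steps $U=(0,1)$, $R=(1,0)$, weakly above $y=x$; it is identified with its word of length $2n$ in $U,R$. Promotion and evacuation. Products are compositions with the rightmost factor applied first. For $1\le i\le N-1$, $N=2n$, the toggle $t_i$ exchanges the $i$-th and $(i+1)$-st letters of the word if the result is again a Dyck path, and otherwise fixes the path. $\partial=t_{N-1}t_{N-2}\cdots t_1$ and $\mathrm{ev}=t_1(t_2t_1)(t_3t_2t_1)\cdots(t_{N-1}\cdots t_2t_1)$. Non-crossing partitions. A set partition of $[n]$ is non-crossing if there are no $i<j<k<l$ with $i,k$ in one block and $j,l$ in a different block. The bijection $\theta=\mathrm{NCPtoDyck}$: put points $1,1',2,2',\dots,n,n'$ on a line from left to right; for each block $\{i_1<\dots<i_p\}$ draw arcs joining $i_q'$ to $i_{q+1}$ for $1\le q\le p$ with $i_{p+1}:=i_1$.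 The $m$-th letter of the Dyck word is $U$ if the $m$-th point is the left end of its arc and $R$ if it is the right end. Maps on $\mathrm{NC}(n)$ (points $1,\dots,n$ placed clockwise on a circle). $\mathrm{Rot}$: replace each $i$ by $i-1$ (with $1\mapsto n$). $\mathrm{Kre}$ (Kreweras complement): put $i'$ between $i$ and $i+1$ (and $n'$ between $n$ and $1$); $i'$ and $j'$ ($i<j$) are in the same block of $\mathrm{Kre}(\pi)$ iff they lie in the same region cut out by the blocks of $\pi$, i.e. no block of $\pi$ contains both an element of $\{i+1,\dots,j\}$ and an element outside it; then drop the primes. $\mathrm{SU}$ (Simion--Ullman): same as $\mathrm{Kre}$, but the label $1'$ is put between $n$ and $1$ and the labels $2',3',\dots$ follow counterclockwise (so $i'$ lies between $n+1-i$ and $n+2-i$, indices mod $n$). $\mathrm{LK}:=\theta^{-1}\circ\widehat{RSK}\circ \mathrm{Dyck}_2\circ\widehat{RSK}^{-1}\circ\theta$, with $\widehat{RSK}$ and $\mathrm{Dyck}_2$ as follows. $\mathrm{Dyck}_2$ and $\widehat{RSK}$ as maps on Dyck paths. For a $321$-avoiding permutation $w\in S_n$, let $p(w)$ be the Dyck path whose peaks (corners $UR$) are exactly the points $(i-1,w_i)$ with $w_i\ge i$; $w\mapsto p(w)$ is a bijection onto Dyck paths of size $n$. Let $q(w)$ be the Dyck path whose valleys (corners $RU$) are exactly the points $(w_i,i-1)$ with $w_i<i$. Then $\mathrm{Dyck}_2(p(w)):=q(w)$. If $(A,B)$ is the pair (insertion tableau, recording tableau) of $w$ under the Robinson--Schensted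 correspondence (row insertion; both tableaux have at most two rows), $\widehat{RSK}(p(w))$ is the Dyck path whose $i$-th step ($1\le i\le n$) is $U$ if $i$ is in the first row of $A$ and $R$ if $i$ is in the second row, and whose $(2n+1-i)$-th step is $R$ if $i$ is in the first row of $B$ and $U$ if $i$ is in the second row. It is a bijection on Dyck paths of size $n$. *)

(* Defs.v *)
(* MathComp.  The set [n] = {1, ..., n} is 'I_n = {0, ..., n-1}: the element
   i : 'I_n stands for the label i.+1.  Positions in Dyck words are shifted
   likewise, but the toggles keep their indices 1, ..., 2n-1. *)
From HB Require Import structures.
From mathcomp Require Import all_boot all_fingroup.

Set Implicit Arguments.
Unset Strict Implicit.
Unset Printing Implicit Defensive.

(* Dyck paths: the letter U is true and the letter R is false. *)

Definition is_dyck (n : nat) (s : seq bool) : bool :=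
  [&& size s == n.*2, count_mem true s == n
    & [forall k : 'I_n.*2.+1,
         count_mem false (take k s) <= count_mem true (take k s)]].

Record dyck (n : nat) := Dyck {
  dyck_word :> n.*2.-tuple bool;
  _ : is_dyck n dyck_word }.

HB.instance Definition _ n := [isSub for @dyck_word n].
HB.instance Definition _ n := [Finite of dyck n by <:].

Lemma count_take_tuple N (s : N.-tuple bool) (b : bool) k : k <= N ->
  count_mem b (take k s) = #|[set m : 'I_N | (m < k) && (tnth s m == b)]|.
Proof.
move=> kN; rewrite -(map_nth_iota0 false) ?size_tuple // count_map.
rewrite -sum1_count.
have -> : iota 0 k = index_iota 0 k by rewrite /index_iota subn0.
rewrite (big_nat_widen 0 k N _ _ kN) big_mkord sum1dep_card cardsE.
apply: eq_card => m; rewrite !inE (tnth_nth false) andbC.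
by [].
Qed.

Lemma top_word_is_dyck n : is_dyck n [tuple m < n | m < n.*2].
Proof.
apply/and3P; split; first by rewrite size_tuple.
- rewrite -[X in count_mem _ X](take_size) count_take_tuple ?size_tuple //.
  set A := [set m | _].
  have le_n : n <= n.*2 by rewrite -addnn leq_addr.
  have -> : A = [set widen_ord le_n i | i in [set: 'I_n]].
    apply/setP => m; rewrite !inE tnth_mktuple ltn_ord eqb_id /=.
    apply/idP/imsetP => [mn|[i _ ->]]; last by rewrite /=.
    by exists (Ordinal mn); rewrite ?inE //; apply: val_inj.
  rewrite card_imset ?cardsT ?card_ord // => i j /(congr1 val) /= ij.
  exact: val_inj.
apply/forallP => k; rewrite !count_take_tuple -1?ltnS //.
have k2 : k <= n.*2 by rewrite -ltnS.
case: (leqP k n) => [kn | nk].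
  rewrite (_ : [set m | _] = set0) ?cards0 //.
  apply/setP => m; rewrite !inE tnth_mktuple; apply/negbTE/negP => /andP[mk].
  by rewrite (leq_trans mk kn).
pose f (m : 'I_n.*2) : 'I_n.*2 := rev_ord m.
rewrite -(card_imset _ (@rev_ord_inj n.*2)); apply: subset_leq_card.
apply/subsetP => m /imsetP[j]; rewrite !inE !tnth_mktuple => /andP[jk].
rewrite eqbF_neg -leqNgt => nj ->.
have lt_n : rev_ord j < n.
  by rewrite /= ltn_subLR // -[X in X < _]addnn addSn ltnS leq_add2r.
by rewrite lt_n (ltn_trans lt_n nk).
Qed.

Definition dyck_top n : dyck n := Dyck (top_word_is_dyck n).

(* [swap_letters i s] exchanges the i-th and (i+1)-st letters of s, for
   1 <= i < N, that is, the entries with indices i.-1 and i. *)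
Definition swap_letters (N i : nat) (s : N.-tuple bool) : N.-tuple bool :=
  [tuple nth false s ([eta id with i.-1 |-> i, i |-> i.-1] (m : nat)) | m < N].

Definition toggle (n i : nat) (D : dyck n) : dyck n :=
  insubd D (swap_letters i D).

(* t_k o ... o t_2 o t_1 *)
Definition toggles (n k : nat) (D : dyck n) : dyck n :=
  foldl (fun D' i => toggle i D') D (iota 1 k).

Definition promotion (n : nat) : dyck n -> dyck n := @toggles n n.*2.-1.

(* t_1 (t_2 t_1) ... (t_{2n-1} ... t_2 t_1): the factor with k = 2n-1 toggles
   is applied first. *)
Definition evacuation (n : nat) (D : dyck n) : dyck n :=
  foldl (fun D' k => toggles k D') D (rev (iota 1 n.*2.-1)).

(* Non-crossing partitions *)

Definition noncrossing (n : nat) (P : {set {set 'I_n}}) : bool :=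
  [forall i : 'I_n, forall j : 'I_n, forall k : 'I_n, forall l : 'I_n,
     [&& i < j, j < k & k < l] ==>
     ~~ [exists B in P, exists C in P,
           [&& B != C, i \in B, k \in B, j \in C & l \in C]]].

Record NC (n : nat) := MkNC {
  NC_blocks :> {set {set 'I_n}};
  _ : partition NC_blocks [set: 'I_n] && noncrossing NC_blocks }.

HB.instance Definition _ n := [isSub for @NC_blocks n].
HB.instance Definition _ n := [Finite of NC n by <:].

Lemma noncrossingP n (P : {set {set 'I_n}}) :
  reflect (forall (i j k l : 'I_n) (B C : {set 'I_n}), B \in P -> C \in P ->
             i < j -> j < k -> k < l ->
             i \in B -> k \in B -> j \in C -> l \in C -> B = C)
          (noncrossing P).
Proof.
apply: (iffP idP) => [ncP i j k l B C BP CP ij jk kl iB kB jC lC | H].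
  move/forallP/(_ i)/forallP/(_ j)/forallP/(_ k)/forallP/(_ l): ncP.
  rewrite ij jk kl /=; apply: contraNeq => BC.
  apply/existsP; exists B; rewrite BP; apply/existsP; exists C.
  by rewrite CP BC iB kB jC lC.
do 4![apply/forallP => ?]; apply/implyP => /and3P[ij jk kl].
apply/existsP => -[B /andP[BP /existsP[C /andP[CP]]]].
by case/and5P => /eqP BC iB kB jC lC; apply: BC; exact: (H _ _ _ _ _ _ BP CP ij jk kl).
Qed.

(* The bijection theta.  The points 1, 1', 2, 2', ..., n, n' are numbered
   0, 1, ..., 2n-1, so that the points i and i' of i : 'I_n have numbers i.*2
   and i.*2.+1.  Since [enum B] is increasing, [next (enum B)] is i_q |-> i_{q+1}
   on the block B, with i_p |-> i_1. *)

Definition next_in_block n (P : {set {set 'I_n}}) (i : 'I_n) : 'I_n :=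
  next (enum (pblock P i)) i.

Definition prev_in_block n (P : {set {set 'I_n}}) (i : 'I_n) : 'I_n :=
  prev (enum (pblock P i)) i.

Lemma half_ord_proof n (m : 'I_n.*2) : m./2 < n.
Proof. by rewrite ltn_half_double. Qed.

Definition half_ord n (m : 'I_n.*2) : 'I_n := Ordinal (half_ord_proof m).

(* The other end of the arc at the point number m. *)
Definition arc_end n (P : {set {set 'I_n}}) (m : 'I_n.*2) : nat :=
  if odd m then (next_in_block P (half_ord m)).*2
  else (prev_in_block P (half_ord m)).*2.+1.

Definition theta_word n (P : {set {set 'I_n}}) : n.*2.-tuple bool :=
  [tuple m < arc_end P m | m < n.*2].

Section ThetaDyck.
Variables (n : nat) (P : {set {set 'I_n}}).
Hypothesis partP : partition P [set: 'I_n].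

Let cov i : i \in cover P. Proof. by rewrite (cover_partition partP) inE. Qed.

Let triv : trivIset P. Proof. by case/and3P: partP. Qed.

Lemma pblock_next i : pblock P (next_in_block P i) = pblock P i.
Proof.
apply: same_pblock => //.
by rewrite -mem_enum /next_in_block mem_next mem_enum mem_pblock.
Qed.

Lemma pblock_prev i : pblock P (prev_in_block P i) = pblock P i.
Proof.
apply: same_pblock => //.
by rewrite -mem_enum /prev_in_block mem_prev mem_enum mem_pblock.
Qed.

Lemma next_in_blockK : cancel (next_in_block P) (prev_in_block P).
Proof.
by move=> i; rewrite /prev_in_block pblock_next prev_next ?enum_uniq.
Qed.

Lemma prev_in_blockK : cancel (prev_in_block P) (next_in_block P).
Proof.
by move=> i; rewrite /next_in_block pblock_prev next_prev ?enum_uniq.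
Qed.

Lemma arc_end_lt m : arc_end P m < n.*2.
Proof.
by rewrite /arc_end; case: odd; rewrite ?ltn_Sdouble ?ltn_double.
Qed.

Let arc m := Ordinal (arc_end_lt m).

Let odd_arc m : odd (arc m) = ~~ odd m.
Proof. by rewrite /= /arc_end; case: (odd m); rewrite /= odd_double. Qed.

Let arcK : involutive arc.
Proof.
move=> m; apply: val_inj; rewrite [LHS]/= {1}/arc_end odd_arc.
case: ifPn => /= [even_m | odd_m].
  have -> : half_ord (arc m) = prev_in_block P (half_ord m).
    apply: val_inj; rewrite /= /arc_end (negbTE even_m).
    by rewrite -uphalfE uphalf_double.
  by rewrite prev_in_blockK even_halfK.
rewrite negbK in odd_m.
have -> : half_ord (arc m) = next_in_block P (half_ord m).
  by apply: val_inj; rewrite /= /arc_end odd_m doubleK.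
by rewrite next_in_blockK odd_halfK // prednK // odd_gt0.
Qed.

Let arc_neq m : (arc m == m :> nat) = false.
Proof.
by apply/eqP => E; have := odd_arc m; rewrite E; case: (odd m).
Qed.

Let arc_inj : injective arc. Proof. exact: inv_inj arcK. Qed.

Lemma theta_word_is_dyck : is_dyck n (theta_word P).
Proof.
have cardUR k : k <= n.*2 ->
    count_mem false (take k (theta_word P)) <=
    count_mem true (take k (theta_word P)).
  move=> kn; rewrite !count_take_tuple // -(card_imset _ arc_inj).
  apply/subset_leq_card/subsetP => m /imsetP[j].
  rewrite !inE !tnth_mktuple -[arc_end P j]/(val (arc j)) => /andP[jk].
  rewrite eqbF_neg -leqNgt leq_eqVlt arc_neq /= => ltj ->.
  rewrite -[arc_end P (arc j)]/(val (arc (arc j))) arcK ltj.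
  by rewrite (ltn_trans ltj jk).
apply/and3P; split; first by rewrite size_tuple.
- set s := theta_word P.
  have sz : count_mem true s + count_mem false s = n.*2.
    rewrite -[RHS](size_tuple s) -(count_predC (pred1 true)); congr (_ + _).
    by apply: eq_count => -[].
  have eqc : count_mem true s = count_mem false s.
    have tk : take n.*2 s = s by rewrite -{1}(size_tuple s) take_size.
    rewrite -{1 2}tk !count_take_tuple // -(card_imset _ arc_inj).
    apply: eq_card => m; apply/imsetP/idP => [[j]|].
      rewrite !inE !tnth_mktuple !ltn_ord /= => /eqP.
      rewrite -[arc_end P j]/(val (arc j)) => ltj ->.
      rewrite -[arc_end P (arc j)]/(val (arc (arc j))) arcK.
      by rewrite eqbF_neg -leqNgt ltnW.
    rewrite !inE tnth_mktuple ltn_ord /= => Hm.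
    exists (arc m); last by rewrite arcK.
    rewrite !inE tnth_mktuple !ltn_ord /=.
    rewrite -[arc_end P (arc m)]/(val (arc (arc m))) arcK eqb_id.
    move: Hm; rewrite -[arc_end P m]/(val (arc m)) eqbF_neg -leqNgt.
    by rewrite leq_eqVlt arc_neq.
  by apply/eqP/double_inj; apply: etrans sz; rewrite -eqc addnn.
by apply/forallP => k; apply: cardUR; rewrite -ltnS.
Qed.

End ThetaDyck.

Lemma NC_partition n (P : NC n) : partition P [set: 'I_n].
Proof. by case: P => P /= /andP[]. Qed.

Lemma NC_noncrossing n (P : NC n) : noncrossing P.
Proof. by case: P => P /= /andP[]. Qed.

Definition theta n (P : NC n) : dyck n :=
  Dyck (theta_word_is_dyck (NC_partition P)).

(* The map Rot: the label i is replaced by i-1, and 1 by n. *)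
Definition rot_blocks n (P : {set {set 'I_n}}) : {set {set 'I_n}} :=
  [set [set ord_pred i | i in B] | B : {set 'I_n} in P].

(* For a : 'I_n, the point a' lies between a and its clockwise successor.
   [same_region P a b] says that a' and b' lie in the same region cut out by
   the blocks of P. *)
Definition same_region n (P : {set {set 'I_n}}) (a b : 'I_n) : bool :=
  ~~ [exists B : {set 'I_n} in P,
        [exists x in B, minn a b < x <= maxn a b] &&
        [exists x in B, ~~ (minn a b < x <= maxn a b)]].

Definition kre_blocks n (P : {set {set 'I_n}}) : {set {set 'I_n}} :=
  equivalence_partition (same_region P) [set: 'I_n].

(* In SU the point i' lies between n+1-i and n+2-i, which is where Kre puts
   (n+1-i)'; and n+1-i is [rev_ord i]. *)
Definition su_blocks n (P : {set {set 'I_n}}) : {set {set 'I_n}} :=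
  equivalence_partition (relpre (@rev_ord n) (same_region P)) [set: 'I_n].

Lemma same_regionP n (P : {set {set 'I_n}}) (a b : 'I_n) :
  reflect (forall B : {set 'I_n}, B \in P -> forall x y : 'I_n,
             x \in B -> y \in B ->
             (a < x) (+) (b < x) = (a < y) (+) (b < y))
          (same_region P a b).
Proof.
have E (x : 'I_n) : (minn a b < x <= maxn a b) = (a < x) (+) (b < x).
  rewrite gtn_min leq_max !(leqNgt x).
  by case: (a < x); case: (b < x).
apply: (iffP idP) => [/negP H B BP x y xB yB | H].
  apply/eqP/negPn/negP => ne; apply: H; apply/existsP; exists B; rewrite BP /=.
  rewrite -!E in ne; apply/andP.
  case Hx: (minn a b < x <= maxn a b) ne => /= ne; split; apply/existsP.
  - by exists x; rewrite xB.
  - by exists y; rewrite yB; case: (_ && _) ne.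
  - by exists y; rewrite yB; case: (_ && _) ne.
  - by exists x; rewrite xB Hx.
apply/negP => /existsP[B /and3P[BP /existsP[x /andP[xB]]]] + /existsP[y].
rewrite E => Hx /andP[yB]; rewrite E -(H B BP x y xB yB).
by rewrite Hx.
Qed.

Lemma same_region_equiv n (P : {set {set 'I_n}}) :
  equivalence_rel (same_region P).
Proof.
apply/equivalence_relP; split=> [a | a b /same_regionP ab c].
  by apply/same_regionP => B BP x y _ _; rewrite !addbb.
apply/same_regionP/same_regionP => H B BP x y xB yB;
  have := H B BP x y xB yB; have := ab B BP x y xB yB;
  by case: (a < x); case: (b < x); case: (c < x);
     case: (a < y); case: (b < y); case: (c < y).
Qed.

Lemma same_region_noncrossing n (P : {set {set 'I_n}}) (i j k l : 'I_n) :
  i < j -> j < k -> k < l ->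
  same_region P i k -> same_region P j l -> same_region P i j.
Proof.
move=> ij jk kl /same_regionP ik /same_regionP jl.
apply/same_regionP => B BP x y xB yB.
have := ik B BP x y xB yB; have := jl B BP x y xB yB.
have mono (a b z : 'I_n) : a < b -> (b < z) ==> (a < z).
  by move=> ab; apply/implyP; exact: ltn_trans.
move: (mono _ _ x ij) (mono _ _ x jk) (mono _ _ x kl).
move: (mono _ _ y ij) (mono _ _ y jk) (mono _ _ y kl).
by case: (i < x); case: (j < x); case: (k < x); case: (l < x);
   case: (i < y); case: (j < y); case: (k < y); case: (l < y).
Qed.

Lemma mem_equivalence_partition n (R : rel 'I_n) (i k : 'I_n) (B : {set 'I_n}) :
  equivalence_rel R -> B \in equivalence_partition R [set: 'I_n] ->
  i \in B -> (k \in B) = R i k.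
Proof.
move=> eqR /imsetP[x _ ->]; rewrite !inE /= => xi.
by case: (eqR x i k) => _ ->.
Qed.

Lemma equivalence_NC n (R : rel 'I_n) :
  equivalence_rel R ->
  (forall i j k l : 'I_n, i < j -> j < k -> k < l -> R i k -> R j l -> R i j) ->
  partition (equivalence_partition R [set: 'I_n]) [set: 'I_n]
  && noncrossing (equivalence_partition R [set: 'I_n]).
Proof.
move=> eqR ncR; have eqRT : {in [set: 'I_n] & &, equivalence_rel R}.
  by move=> x y z _ _ _; exact: eqR.
rewrite equivalence_partitionP //=.
apply/noncrossingP => i j k l B C BP CP ij jk kl iB kB jC lC.
have Rik : R i k by rewrite -(mem_equivalence_partition _ eqR BP iB).
have Rjl : R j l by rewrite -(mem_equivalence_partition _ eqR CP jC).
have jB : j \in B.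
  by rewrite (mem_equivalence_partition _ eqR BP iB) (ncR i j k l).
apply/setP => z; rewrite (mem_equivalence_partition _ eqR BP jB).
by rewrite (mem_equivalence_partition _ eqR CP jC).
Qed.

Lemma kre_blocks_NC n (P : {set {set 'I_n}}) :
  partition (kre_blocks P) [set: 'I_n] && noncrossing (kre_blocks P).
Proof.
apply: equivalence_NC; first exact: same_region_equiv.
exact: same_region_noncrossing.
Qed.

Lemma su_blocks_NC n (P : {set {set 'I_n}}) :
  partition (su_blocks P) [set: 'I_n] && noncrossing (su_blocks P).
Proof.
have eqR := same_region_equiv P.
have sym a b : same_region P a b = same_region P b a.
  have /equivalence_relP[refl trans] := eqR.
  by apply/idP/idP => /trans <-.
have /equivalence_relP[_ tr] := eqR.
apply: equivalence_NC => [x y z | i j k l ij jk kl /= ik jl]; first exact: eqR.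
have rev (a b : 'I_n) : a < b -> rev_ord b < rev_ord a.
  by move=> ab; rewrite /= ltn_sub2l // (leq_trans _ (ltn_ord b)).
have lj : same_region P (rev_ord l) (rev_ord k).
  by apply: (same_region_noncrossing (rev _ _ kl) (rev _ _ jk) (rev _ _ ij));
    rewrite sym.
rewrite (tr _ _ ik) (tr _ _ (_ : same_region P (rev_ord k) (rev_ord l))).
  by rewrite sym.
by rewrite sym.
Qed.

Lemma rot_blocks_NC n (P : {set {set 'I_n}}) :
  partition P [set: 'I_n] -> noncrossing P ->
  partition (rot_blocks P) [set: 'I_n] && noncrossing (rot_blocks P).
Proof.
move=> partP /noncrossingP ncP; apply/andP; split.
  have <- : @ord_pred n @: [set: 'I_n] = [set: 'I_n].
    by apply/setP => i; rewrite inE -(ordSK i) imset_f ?inE.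
  by rewrite imset_partition //; exact: ord_pred_inj.
apply/noncrossingP => i j k l _ _ /imsetP[B BP ->] /imsetP[C CP ->] ij jk kl.
have mem (X : {set 'I_n}) (x : 'I_n) :
    x \in [set ord_pred y | y in X] = (ordS x \in X).
  by rewrite -{1}(ordSK x) mem_imset //; exact: ord_pred_inj.
have valS (x : 'I_n) : x < l -> ordS x = x.+1 :> nat.
  by move=> xl; rewrite /= modn_small // (leq_trans _ (ltn_ord l)).
rewrite !mem => iB kB jC lC; have jl := ltn_trans jk kl.
have il := ltn_trans ij jl; suff -> : B = C by [].
have [ln | nl] := ltnP l.+1 n.
  have lS : ordS l = l.+1 :> nat by rewrite /= (modn_small ln).
  by apply: (ncP _ _ _ _ _ _ BP CP _ _ _ iB kB jC lC);
    rewrite ?lS ?(valS i) ?(valS j) ?(valS k).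
have l0 : ordS l = 0 :> nat.
  by rewrite /= (_ : l.+1 = n) ?modnn //; apply/anti_leq; rewrite nl ltn_ord.
by apply/esym/(ncP _ _ _ _ _ _ CP BP _ _ _ lC jC iB kB); 
    rewrite ?l0 ?(valS i) ?(valS j) ?(valS k).
Qed.

Definition Rot n (P : NC n) : NC n :=
  MkNC (rot_blocks_NC (NC_partition P) (NC_noncrossing P)).

Definition Kre n (P : NC n) : NC n := MkNC (kre_blocks_NC P).

Definition SU n (P : NC n) : NC n := MkNC (su_blocks_NC P).

(* Inverses and "the unique x such that Q x" on finite types.  The value x0 is
   only returned when there is no such x. *)

Definition the (A : finType) (x0 : A) (Q : pred A) : A := odflt x0 [pick x | Q x].

Definition inverse (A B : finType) (x0 : A) (f : A -> B) (y : B) : A :=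
  the x0 (fun x => f x == y).

(* The discrete partition. *)
Lemma NC_default_proof n :
  partition (equivalence_partition eq_op [set: 'I_n]) [set: 'I_n]
  && noncrossing (equivalence_partition eq_op [set: 'I_n]).
Proof.
apply: equivalence_NC => [x y z | i j k l ij jk _ /eqP ik].
  by rewrite eqxx; split=> // /eqP ->.
by have := ltn_trans ij jk; rewrite ik ltnn.
Qed.

Definition NC_default n : NC n := MkNC (NC_default_proof n).

Definition theta_inv n : dyck n -> NC n := inverse (NC_default n) (@theta n).

(* X ~ Y *)
Definition corresponds n (X : NC n -> NC n) (Y : dyck n -> dyck n) : Prop :=
  X =1 @theta_inv n \o Y \o @theta n.

(* 321-avoiding permutations.  The arguments and values of w : 'S_n are shifted
   by one: the w_i of the mathematical text is (w i).+1 with i replaced by i.+1. *)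

Definition avoids321 n (w : 'S_n) : bool :=
  ~~ [exists i : 'I_n, exists j : 'I_n, exists k : 'I_n,
        [&& i < j, j < k, w j < w i & w k < w j]].

Record av321 n := Av321 { av321_perm :> 'S_n; _ : avoids321 av321_perm }.

HB.instance Definition _ n := [isSub for @av321_perm n].
HB.instance Definition _ n := [Finite of av321 n by <:].

Lemma avoids321_1 n : avoids321 (1%g : 'S_n).
Proof.
apply/existsP => -[i /existsP[j /existsP[k /and4P[ij _ ]]]].
by rewrite !perm1 ltnNge ltnW.
Qed.

Definition av321_1 n : av321 n := Av321 (avoids321_1 n).

(* The point (x, y) reached after the first k steps of the word s. *)
Definition vertex (s : seq bool) (k : nat) : nat * nat :=
  (count_mem false (take k s), count_mem true (take k s)).

(* The vertices of s at which a step a is followed by a step b. *)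
Definition corners (a b : bool) (s : seq bool) : seq (nat * nat) :=
  [seq vertex s k | k <- iota 1 (size s).-1
                  & (nth false s k.-1 == a) && (nth false s k == b)].

Definition peaks : seq bool -> seq (nat * nat) := corners true false.

Definition valleys : seq bool -> seq (nat * nat) := corners false true.

(* Both sides of each [perm_eq] below are duplicate-free. *)

Definition path_p n (w : av321 n) : dyck n :=
  the (dyck_top n) (fun D =>
    perm_eq (peaks D) [seq (i : nat, (w i).+1) | i : 'I_n <- enum 'I_n & i <= w i]).

Definition path_q n (w : av321 n) : dyck n :=
  the (dyck_top n) (fun D =>
    perm_eq (valleys D) [seq ((w i).+1, i : nat) | i : 'I_n <- enum 'I_n & w i < i]).

Definition path_p_inv n : dyck n -> av321 n := inverse (av321_1 n) (@path_p n).

Definition Dyck2 n (D : dyck n) : dyck n := path_q (path_p_inv D).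

(* Robinson-Schensted.  A tableau is the sequence of its rows. *)

(* Row insertion of x; the second component is the index of the row in which
   the new cell is created. *)
Fixpoint row_insert (x : nat) (T : seq (seq nat)) : seq (seq nat) * nat :=
  if T is r :: T' then
    let k := find (fun y => x < y) r in
    if k < size r then
      let: (T'', j) := row_insert (nth 0 r k) T' in
      (set_nth 0 r k x :: T'', j.+1)
    else (rcons r x :: T', 0)
  else ([:: [:: x]], 0).

Definition add_cell (j x : nat) (T : seq (seq nat)) : seq (seq nat) :=
  set_nth [::] T j (rcons (nth [::] T j) x).

Definition RS_step (AB : seq (seq nat) * seq (seq nat)) (ix : nat * nat) :
    seq (seq nat) * seq (seq nat) :=
  let: (A, j) := row_insert ix.2 AB.1 in (A, add_cell j ix.1 AB.2).

(* The pair (insertion tableau, recording tableau) of the word s, where the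
   recording tableau has the entries 0, ..., size s - 1. *)
Definition RS (s : seq nat) : seq (seq nat) * seq (seq nat) :=
  foldl RS_step ([::], [::]) (zip (iota 0 (size s)) s).

Definition RS_perm n (w : 'S_n) : seq (seq nat) * seq (seq nat) :=
  RS [seq w i : nat | i : 'I_n <- enum 'I_n].

Definition RSK_word n (w : 'S_n) : n.*2.-tuple bool :=
  let: (A, B) := RS_perm w in
  [tuple if m < n then (m : nat) \in nth [::] A 0
         else (rev_ord m : nat) \in nth [::] B 1 | m < n.*2].

(* [RSK_word w] is a Dyck path for every 321-avoiding w, so that the default
   value of [insubd] is not used. *)
Definition RSK_hat n (D : dyck n) : dyck n :=
  insubd (dyck_top n) (RSK_word (path_p_inv D)).

Definition LK n : NC n -> NC n :=
  @theta_inv n \o @RSK_hat n \o @Dyck2 n \o finv (@RSK_hat n) \o @theta n.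

(* Main.v *)
Require Import Defs.
From mathcomp Require Import all_boot all_fingroup.
From mathcomp Require Import zify.

(** Why the proposition holds.

    A Dyck word of length 2n is a non-crossing matching of 2n points on a circle,
    a letter U opening an arc and a letter R closing it.  For points a <= b let
    c(a, b) be the number of arcs that leave the interval from a to b ([cut]).
    The numbers c(0, b) are the heights of the word, and the four numbers c(a, b),
    c(a + 1, b), c(a, b + 1), c(a + 1, b + 1) satisfy the local rule
    c(a + 1, b + 1) = |c(a + 1, b) + c(a, b + 1) - c(a, b)| ([cut_local]).  A
    toggle changes one height by the same rule ([ht_toggle]).  Hence promotion
    replaces the row c(0, _) by the row c(1, _), which turns the matching by one
    point ([cut_promotion]), and evacuation reads the last column c(_, 2n)
    backwards, which reflects the matching ([ht_evacuation]).

    The word theta(P) is the word of the matching whose arcs join i' to the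
    successor of i in its block.  The successor function of Kre(P) is the inverse
    of that of P after the long cycle ([next_Kre]), so Kre turns the matching by
    one point ([arc_Kre], [theta_Kre]); applying this twice gives the successor
    function of Rot(P) ([Rot_Kre]), and SU(P) is a mirror image of Kre(P)
    ([arc_SU], [theta_SU]).  The map theta is injective, since a word determines
    the arc of its first letter, and turning it determines the others
    ([theta_inj]).

    For LK, consider the zigzag c(0, 2n), c(0, 2n - 1), c(1, 2n - 1),
    c(1, 2n - 2), ..., which determines the word by the local rule
    ([zigzag_inj]).  Let w avoid 321 and take the word of its pair of tableaux,
    whose left half reads the values and whose right half reads the positions
    backwards.  The zigzag then reads position 1, value 1, position 2, value 2,
    and so on, and the key fact is that it goes up at a position that is a weak
    excedance and down at a value of a weak excedance, and the other way round at
    the other positions and values ([zigzag_RSK]).  To see this, the insertion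
    algorithm is described by parentheses, a bumped value closing the value
    that bumps it ([scan]); this keeps track of the positions and values
    that are still unmatched in the part of the matching already read
    ([open_vals_pos], [open_vals_val]).  The arcs between positions and values
    that are read at each moment then make up the minimum that enters c
    ([zigzag_rmin]).

    Peaks of a path alternate with its valleys.  If the path p(w') is q(w), this
    makes the weak excedances of w' the non-excedances of w, shifted by one
    ([exc_Dyck2]).  By the local rule, the same shift of the zigzag leads from
    the promotion of a word to its evacuation ([zigzag_evacuation]), so
    Dyck_2 becomes the inverse of promotion followed by evacuation
    ([RSK_hat_Dyck2]).  The key fact also makes the tableaux an injection of
    321-avoiding permutations into Dyck paths; since paths inject into these
    permutations by their peaks and by their valleys, all these maps are
    bijections ([path_exists]). *)

Set Implicit Arguments.
Unset Strict Implicit.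
Unset Printing Implicit Defensive.

(** * Heights of Dyck words *)

Definition ups (s : seq bool) (k : nat) : nat := count id (take k s).

(** On prefixes of Dyck words, the only ones of interest here, the truncated
    subtraction is exact. *)
Definition ht (s : seq bool) (k : nat) : nat := (ups s k).*2 - k.

Lemma upsS (s : seq bool) k : k < size s ->
  ups s k.+1 = ups s k + nth false s k.
Proof. by move=> ks; rewrite /ups (take_nth false ks) -cats1 count_cat /= addn0. Qed.

Lemma count_take_true (s : seq bool) k : count_mem true (take k s) = ups s k.
Proof. by apply: eq_count => -[]. Qed.

Lemma count_take_false (s : seq bool) k : k <= size s ->
  count_mem false (take k s) = k - ups s k.
Proof.
move=> ks; rewrite -{2}(size_takel ks) -(count_predC id) addKn.
by apply: eq_count => -[].
Qed.

Lemma is_dyckP n (s : seq bool) :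
  reflect [/\ size s = n.*2, ups s n.*2 = n
            & forall k, k <= n.*2 -> k <= (ups s k).*2]
          (is_dyck n s).
Proof.
apply: (iffP and3P) => [[/eqP sz /eqP ct /forallP H]|[sz ct H]]; split=> //.
- by rewrite -count_take_true -sz take_size.
- move=> k kn; have := H (Ordinal (kn : k < n.*2.+1)) => /=.
  by rewrite count_take_false ?sz // count_take_true; lia.
- exact/eqP.
- by rewrite -[s]take_size count_take_true sz ct.
- apply/forallP => -[k /= kn]; rewrite ltnS in kn; have := H k kn.
  by rewrite count_take_false ?sz // count_take_true; lia.
Qed.

Section DyckHeights.
Variable n : nat.
Implicit Types D : dyck n.

Lemma dyckP D :
  [/\ size D = n.*2, ups D n.*2 = n
    & forall k, k <= n.*2 -> k <= (ups D k).*2].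
Proof. by case: D => D /= /is_dyckP. Qed.

Lemma ups_ht D k : k <= n.*2 -> (ups D k).*2 = ht D k + k.
Proof. by move=> kn; have [_ _ /(_ k kn)] := dyckP D; rewrite /ht; lia. Qed.

Lemma ht0 D : ht D 0 = 0. Proof. by rewrite /ht /ups take0. Qed.

Lemma ht_end D : ht D n.*2 = 0.
Proof. by have [_ ct _] := dyckP D; rewrite /ht ct; lia. Qed.

Lemma htS D k : k < n.*2 ->
  if nth false D k then ht D k.+1 = (ht D k).+1 else ht D k = (ht D k.+1).+1.
Proof.
move=> kn; have [sz _ _] := dyckP D; have := @upsS D k; rewrite sz => /(_ kn).
have := ups_ht D (ltnW kn); have := ups_ht D kn.
by case: nth => /=; lia.
Qed.

Lemma ht_letter D k : k < n.*2 -> nth false D k = (ht D k < ht D k.+1).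
Proof. by move=> kn; have := htS D kn; case: nth; lia. Qed.

Lemma dyck_ht_inj D D' : (forall k, k <= n.*2 -> ht D k = ht D' k) -> D = D'.
Proof.
move=> H; apply/val_inj/val_inj/(@eq_from_nth _ false).
  by rewrite !size_tuple.
by rewrite size_tuple => k kn; rewrite -!/(dyck_word _) !ht_letter // !H // ltnW.
Qed.

End DyckHeights.

(** * Cuts *)

Fixpoint rmin (h : nat -> nat) (a d : nat) : nat :=
  if d is d'.+1 then minn (rmin h a d') (h (a + d)) else h a.

(** In the non-crossing matching of a Dyck word with heights h, this is the
    number of arcs with exactly one end among the letters a, ..., b - 1. *)
Definition cut (h : nat -> nat) (a b : nat) : nat :=
  h a + h b - (rmin h a (b - a)).*2.

Lemma rmin_left h a d : rmin h a d.+1 = minn (h a) (rmin h a.+1 d).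
Proof.
elim: d => [|d IH]; first by rewrite /= addn1.
by rewrite [LHS]/= -/(rmin h a d.+1) IH /= addSnnS minnA.
Qed.

Lemma rmin_le h a d t : a <= t <= a + d -> rmin h a d <= h t.
Proof.
elim: d => [|d IH] /= at_; first by rewrite (_ : t = a) //; lia.
rewrite geq_min; have [->|ne] := eqVneq t (a + d.+1); first by rewrite leqnn orbT.
by rewrite IH //; lia.
Qed.

Lemma rmin_eq h h' a d : (forall t, a <= t <= a + d -> h t = h' t) ->
  rmin h a d = rmin h' a d.
Proof.
elim: d => [|d IH] H /=; first by rewrite H //; lia.
by rewrite IH ?H //; [lia | move=> t ?; apply: H; lia].
Qed.

Lemma rmin_rev h m a d : a + d <= m ->
  rmin (fun t => h (m - t)) a d = rmin h (m - (a + d)) d.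
Proof.
elim: d => [|d IH] ad; first by rewrite /= addn0.
rewrite [RHS]rmin_left [LHS]/= IH; last lia.
by rewrite minnC (_ : (m - (a + d.+1)).+1 = m - (a + d)) //; lia.
Qed.

Lemma cutxx h a : cut h a a = 0.
Proof. by rewrite /cut subnn /=; lia. Qed.

Lemma eq_cut h h' a b : a <= b -> (forall t, a <= t <= b -> h t = h' t) ->
  cut h a b = cut h' a b.
Proof.
move=> ab H; rewrite /cut !H ?leqnn ?ab //.
by rewrite (@rmin_eq h h') // => t ?; apply: H; lia.
Qed.

Lemma cut_rev h m a b : a <= b -> b <= m ->
  cut (fun t => h (m - t)) a b = cut h (m - b) (m - a).
Proof.
move=> ab bm; rewrite /cut rmin_rev; last lia.
by rewrite addnC; congr (_ + _ - (rmin _ _ _).*2); lia.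
Qed.

Lemma cut_rmin h a b : a <= b ->
  cut h a b + (rmin h a (b - a)).*2 = h a + h b.
Proof.
move=> ab; rewrite /cut; have := @rmin_le h a (b - a) a; have := @rmin_le h a (b - a) b.
lia.
Qed.

Definition unit_steps (h : nat -> nat) (m : nat) :=
  forall k, k < m -> h k.+1 = (h k).+1 \/ h k = (h k.+1).+1.

Lemma unit_steps_ht n (D : dyck n) : unit_steps (ht D) n.*2.
Proof. by move=> k /(htS D); case: nth; [left | right]. Qed.

(** This is |x + y - z|. *)
Definition flip (x y z : nat) : nat := (x + y - z) + (z - (x + y)).

(** The local rule of growth diagrams.  If the letters a and b are matched with
    each other, no arc leaves the interval between them; otherwise each of them
    adds 1 or -1 to the cuts, independently of the other. *)
Lemma cut_locals h m a b : unit_steps h m -> a < b -> b < m ->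
  cut h a.+1 b.+1 = flip (cut h a.+1 b) (cut h a b.+1) (cut h a b) /\
  cut h a b = flip (cut h a.+1 b) (cut h a b.+1) (cut h a.+1 b.+1).
Proof.
rewrite /flip => hS ab bm; have ha := hS a (ltn_trans ab bm); have hb := hS b bm.
have [d bE] : exists d, b = a + d.+1 by exists (b - a.+1); lia.
have e1 := @cut_rmin h a.+1 b.+1; have e2 := @cut_rmin h a.+1 b.
have e3 := @cut_rmin h a b.+1; have e4 := @cut_rmin h a b.
have ld := @rmin_le h a.+1 d a.+1; have rd := @rmin_le h a.+1 d b.
move: e1 e2 e3 e4.
rewrite (_ : b.+1 - a.+1 = d.+1); last lia.
rewrite (_ : b - a.+1 = d); last lia.
rewrite (_ : b.+1 - a = d.+2); last lia.
rewrite (_ : b - a = d.+1); last lia.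
rewrite !(rmin_left h a) [rmin h a.+1 d.+1]/= (_ : a.+1 + d.+1 = b.+1); lia.
Qed.

Lemma cut_local h m a b : unit_steps h m -> a < b -> b < m ->
  cut h a.+1 b.+1 = flip (cut h a.+1 b) (cut h a b.+1) (cut h a b).
Proof. by move=> hS ab bm; case: (cut_locals hS ab bm). Qed.

Lemma cut_local_inv h m a b : unit_steps h m -> a < b -> b < m ->
  cut h a b = flip (cut h a.+1 b) (cut h a b.+1) (cut h a.+1 b.+1).
Proof. by move=> hS ab bm; case: (cut_locals hS ab bm). Qed.

(** * Toggles, promotion and evacuation in terms of heights *)

Lemma ups_swap_letters N i (s : N.-tuple bool) k : 0 < i < N -> k <= N ->
  ups (swap_letters i s) k =
  if k == i then ups s i.-1 + nth false s i else ups s k.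
Proof.
move=> iN; elim: k => [|k IH] kN; first by rewrite ifF; [rewrite /ups !take0 | lia].
rewrite !upsS ?size_tuple // IH ?(ltnW kN) //.
have -> : nth false (swap_letters i s) k =
    nth false s ([eta id with i.-1 |-> i, i |-> i.-1] k).
  by rewrite -(tnth_nth false (swap_letters i s) (Ordinal kN)) tnth_mktuple.
case: i iN {IH} => // i iN /=.
have [->|ki] := eqVneq k i.
  by rewrite eqxx ifF //; lia.
rewrite eqSS (negbTE ki); case: eqP => // ->.
by rewrite (@upsS s i) ?size_tuple; lia.
Qed.

(** Exchanging two different letters reflects the height between them, and is
    impossible exactly when the reflected height would be -1. *)
Lemma ht_toggle n (D : dyck n) i k : 0 < i < n.*2 -> k <= n.*2 ->
  ht (toggle i D) k =
  if k == i then flip (ht D i.-1) (ht D i.+1) (ht D i) else ht D k.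
Proof.
move=> iN kN; have [sz ct H] := dyckP D; have [i0 i1] := andP iN.
have := @upsS D i.-1; have := @upsS D i; rewrite sz prednK //.
move=> /(_ i1) u1 /(_ (ltnW i1)) u0.
have := ups_ht D (ltnW i1); have := ups_ht D i1.
have := @ups_ht _ D i.-1; rewrite /flip.
have -> : dyck_word (toggle i D) =
    if is_dyck n (swap_letters i D) then swap_letters i D else dyck_word D.
  exact: val_insubd.
case: is_dyckP => [[_ _ /(_ i (ltnW i1))] | nd].
  by rewrite /ht !ups_swap_letters ?eqxx ?(ltnW i1) //; case: eqP => [->|]; lia.
case: eqP => // -> e0 e1 e2; suff : i > (ups D i.-1 + nth false D i).*2 by lia.
rewrite ltnNge; apply/negP => le_i; case: nd; split; first by rewrite size_tuple.
  by rewrite ups_swap_letters // ifF //; lia.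
by move=> j jN; rewrite ups_swap_letters //; case: eqP => [->|_]; rewrite ?H.
Qed.

Lemma toggleK n i : 0 < i < n.*2 -> involutive (@toggle n i).
Proof.
move=> iN D; apply: dyck_ht_inj => k kN.
rewrite ht_toggle //; case: eqP => [->|/eqP ki]; last first.
  by rewrite ht_toggle // (negbTE ki).
have [i0 i1] := andP iN; rewrite !ht_toggle ?eqxx //; try lia.
rewrite !ifF; try lia.
have := @unit_steps_ht _ D i i1; have := @unit_steps_ht _ D i.-1.
by rewrite prednK // /flip; lia.
Qed.

Lemma iota1S k : iota 1 k.+1 = rcons (iota 1 k) k.+1.
Proof. by rewrite -[in LHS](addn1 k) iotaD cats1 add1n. Qed.

Lemma togglesS n k (D : dyck n) : toggles k.+1 D = toggle k.+1 (toggles k D).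
Proof. by rewrite /toggles iota1S foldl_rcons. Qed.

Lemma promotion_inj n : injective (@promotion n).
Proof.
have H k : k < n.*2 -> injective (@toggles n k).
  elim: k => [|k IH] kn // D D'; rewrite !togglesS => E.
  by apply: (IH (ltnW kn)); apply: (inv_inj (@toggleK n k.+1 _)) E.
rewrite /promotion; case: n H => [|n] H; first by move=> D D'.
by apply: H; lia.
Qed.

(** If x lists the heights of D, then t_1, ..., t_k replace x by y one entry at
    a time, y being the neighbouring row of the growth diagram. *)
Lemma ht_toggles n (D : dyck n) (x y : nat -> nat) k : k < n.*2 ->
    (forall j, j <= k.+1 -> ht D j = x j) -> y 0 = 0 ->
    (forall j, 0 < j <= k -> y j = flip (y j.-1) (x j.+1) (x j)) ->
  forall j, j <= n.*2 -> ht (toggles k D) j = if j <= k then y j else ht D j.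
Proof.
elim: k => [|k IH] kn xD y0 yx j jn.
  by rewrite /toggles leqn0; case: eqP => // ->; rewrite y0 ht0.
have {}IH := IH (ltnW kn) (fun j jk => xD j (leqW jk)) y0.
have {}IH : forall j, j <= n.*2 -> ht (toggles k D) j = if j <= k then y j else ht D j.
  by apply: IH => i ?; apply: yx; lia.
rewrite togglesS ht_toggle ?kn //; case: eqP => [->|ne].
  rewrite leqnn yx ?leqnn // !IH; try lia.
  by rewrite leqnn ltnn ltnNge leqnSn /= !xD.
by rewrite IH //; case: ifP; case: ifP => //; lia.
Qed.

Lemma cut_from0 n (D : dyck n) j : cut (ht D) 0 j = ht D j.
Proof.
have /(_ (leq0n _)) := @rmin_le (ht D) 0 (j - 0) 0.
by rewrite /cut ht0; lia.
Qed.

Lemma cut_to_end n (D : dyck n) a : a <= n.*2 -> cut (ht D) a n.*2 = ht D a.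
Proof.
move=> an; rewrite /cut ht_end; have := @rmin_le (ht D) a (n.*2 - a) n.*2.
by rewrite ht_end; lia.
Qed.

Lemma ht_promotion n (D : dyck n) j : j < n.*2 ->
  ht (promotion D) j = cut (ht D) 1 j.+1.
Proof.
move=> jn; rewrite /promotion.
rewrite (@ht_toggles _ _ (cut (ht D) 0) (fun j => cut (ht D) 1 j.+1)); try lia.
- by rewrite ifT //; lia.
- by move=> i _; rewrite cut_from0.
- by rewrite cutxx.
- move=> i iN /=; rewrite (@cut_local (ht D) n.*2) ?prednK //; try lia.
  exact: unit_steps_ht.
Qed.

(** Both sides obey the local rule and vanish for a = b, so that the equality of
    their first rows propagates to the other rows. *)
Lemma cut_promotion n (D : dyck n) a b : a <= b -> b < n.*2 ->
  cut (ht (promotion D)) a b = cut (ht D) a.+1 b.+1.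
Proof.
elim: a b => [|a IH] b ab bn.
  by rewrite cut_from0 ht_promotion.
elim: b ab bn => // b IHb; rewrite ltnS leq_eqVlt => /predU1P[-> _|ab bn].
  by rewrite !cutxx.
have hS := unit_steps_ht D; have hS' := unit_steps_ht (promotion D).
rewrite (cut_local hS') ?[RHS](cut_local hS); try lia.
by rewrite IHb ?(IH b) ?(IH b.+1) //; lia.
Qed.

(** When the factors with at most k toggles remain, the heights of the current
    word E follow row r of the growth diagram of D and then its last column,
    whose entries no later factor touches. *)
Lemma ht_evacuation_from n (D E : dyck n) k r : r + k.+1 = n.*2 ->
    (forall j, j <= k.+1 -> ht E j = cut (ht D) r (r + j)) ->
    (forall j, k < j <= n.*2 -> ht E j = ht D (n.*2 - j)) ->
  forall j, j <= n.*2 ->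
    ht (foldl (fun D' i => toggles i D') E (rev (iota 1 k))) j = ht D (n.*2 - j).
Proof.
elim: k E r => [|k IH] E r rk E1 E2 j jn.
  case: j jn => [|j] jn /=; last by rewrite E2.
  by rewrite ht0 subn0 ht_end.
have -> : rev (iota 1 k.+1) = k.+1 :: rev (iota 1 k).
  by rewrite iota1S rev_rcons.
rewrite /=; have hS := unit_steps_ht D.
have HT : forall j, j <= n.*2 -> ht (toggles k.+1 E) j =
    if j <= k.+1 then cut (ht D) r.+1 (r.+1 + j) else ht E j.
  apply: (@ht_toggles _ _ (fun j => cut (ht D) r (r + j))) => //.
  - lia.
  - by rewrite addn0 cutxx.
  - move=> i iN; rewrite (addSn r i) (cut_local hS); try lia.
    by rewrite (_ : r.+1 + i.-1 = r + i) ?addnS //; lia.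
apply: (IH _ r.+1) => //; first lia.
- by move=> i ik; rewrite HT ?ik //; lia.
- move=> i ik; rewrite HT; last lia.
  case: ifP => ik'; last by apply: E2; lia.
  have -> : i = k.+1 by lia.
  rewrite (_ : r.+1 + k.+1 = n.*2) ?cut_to_end; try lia.
  by congr (ht D _); lia.
Qed.

Lemma ht_evacuation n (D : dyck n) j : 0 < n -> j <= n.*2 ->
  ht (evacuation D) j = ht D (n.*2 - j).
Proof.
move=> n0 jn; apply: (@ht_evacuation_from n D D _ 0) => //; first lia.
- by move=> i _; rewrite add0n cut_from0.
- move=> i iN; have -> : i = n.*2 by lia.
  by rewrite subnn ht_end ht0.
Qed.

Lemma cut_evacuation n (D : dyck n) a b : 0 < n -> a <= b -> b <= n.*2 ->
  cut (ht (evacuation D)) a b = cut (ht D) (n.*2 - b) (n.*2 - a).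
Proof.
move=> n0 ab bn; rewrite -cut_rev //; apply: eq_cut => // t t_.
by rewrite ht_evacuation //; lia.
Qed.

(** * Successors in the blocks of a partition *)

(** The point k lies strictly inside the clockwise way from i to j, where the way
    from i to i is the whole circle. *)
Definition cyc_between (i k j : nat) : bool :=
  ((i < j) && (i < k < j)) || ((j <= i) && ((i < k) || (k < j))).

Lemma sorted_enum_set n (B : {set 'I_n}) : sorted ltn (map val (enum B)).
Proof.
rewrite sorted_map {1}/enum_mem; apply: sorted_filter.
  by move=> x y z /=; exact: ltn_trans.
have := iota_ltn_sorted 0 n.
by rewrite -val_enum_ord sorted_map -enumT.
Qed.

Lemma next_enum_between n (B : {set 'I_n}) (i k : 'I_n) :
  i \in B -> k \in B -> ~~ cyc_between i k (next (enum B) i).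
Proof.
rewrite -!(mem_enum B); have := sorted_enum_set B.
case: (enum B) => // x s sS iB kB.
pose f j := nth (val x) (map val (x :: s)) j.
have lt a b : b <= size s -> a < b -> f a < f b.
  move=> bs ab; apply: (sorted_ltn_nth ltn_trans) => //.
    by rewrite unfold_in /= size_map ltnS (ltnW (leq_trans ab bs)).
  by rewrite unfold_in /= size_map ltnS.
have le a b : b <= size s -> a <= b -> f a <= f b.
  by move=> bs; rewrite leq_eqVlt => /orP[/eqP -> //|/(lt _ _ bs)/ltnW].
have as_ : index i (x :: s) <= size s by rewrite -[_ <= _]/(_ < size (x :: s)) index_mem.
have bs : index k (x :: s) <= size s by rewrite -[_ <= _]/(_ < size (x :: s)) index_mem.
have fE (y : 'I_n) : y \in x :: s -> nat_of_ord y = f (index y (x :: s)).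
  by move=> yB; rewrite /f (nth_map x) ?index_mem // nth_index.
rewrite next_nth iB (fE i iB) (fE k kB) /cyc_between.
move: (index i _) (index k _) as_ bs => a b as_ bs.
have [{}as_|sa] := ltnP a (size s).
  have -> : nat_of_ord (nth x s a) = f a.+1 by rewrite /f /= (nth_map x).
  have := lt a a.+1 as_ (leqnn _); move: f {fE} lt le => f lt le.
  have [ba|ab] := leqP b a; first by have := le b a (ltnW as_) ba; lia.
  by have := le a.+1 b bs ab; lia.
rewrite nth_default // -[nat_of_ord x]/(f 0); move: f {fE} lt le => f lt le.
have := le 0 a as_ (leq0n _); have := le 0 b bs (leq0n _).
have := le b a as_ (leq_trans bs sa); lia.
Qed.

Section Partition.
Variables (n : nat) (P : {set {set 'I_n}}).
Hypothesis partP : partition P [set: 'I_n].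
Implicit Types i j k : 'I_n.

Lemma mem_pblockE i j : (j \in pblock P i) = (pblock P i == pblock P j).
Proof.
by rewrite eq_pblock ?(cover_partition partP) ?inE //; case/and3P: partP.
Qed.

Lemma pblock_mem_self i : i \in pblock P i.
Proof. by rewrite mem_pblockE. Qed.

Lemma mem_block (B : {set 'I_n}) i : B \in P -> i \in B -> pblock P i = B.
Proof. by case/and3P: partP => _ tP _; exact: def_pblock. Qed.

Lemma next_in_block_between i k :
  pblock P i = pblock P k -> ~~ cyc_between i k (next_in_block P i).
Proof.
move=> ik; apply: next_enum_between; first exact: pblock_mem_self.
by rewrite mem_pblockE ik.
Qed.

(** This characterises successors without the enumeration of the block, and is
    stable under rotations and reflections of the circle. *)
Lemma next_in_blockP i j : pblock P i = pblock P j ->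
  (forall k, pblock P i = pblock P k -> ~~ cyc_between i k j) ->
  next_in_block P i = j.
Proof.
move=> ij Hj; apply: val_inj; have := next_in_block_between ij.
have := Hj _ (esym (pblock_next partP i)); rewrite /cyc_between /=; lia.
Qed.

Lemma prev_in_blockP i j : (prev_in_block P j == i) = (next_in_block P i == j).
Proof.
apply/eqP/eqP => [<-|<-]; first exact: prev_in_blockK.
exact: next_in_blockK.
Qed.

End Partition.

(** The successors of i reach every later element of its block. *)
Lemma eq_block_next n (P Q : {set {set 'I_n}}) (i j : 'I_n) :
    partition P [set: 'I_n] -> partition Q [set: 'I_n] ->
    next_in_block P =1 next_in_block Q ->
  pblock P i = pblock P j -> pblock Q i = pblock Q j.
Proof.
move=> pP pQ PQ; wlog: i j / i <= j => [H|ij].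
  have [ij|/ltnW ji] := leqP i j; first exact: H.
  by move=> e; apply/esym/H.
have [m] := ubnP (j - i); elim: m i ij => // m IH i ij mij eij.
have [/val_inj -> //|ne] := eqVneq (i : nat) j.
have := next_in_block_between pP eij; rewrite /cyc_between => b.
rewrite -(pblock_next pQ i) -PQ; apply: IH; try by move: b; lia.
by rewrite pblock_next.
Qed.

Lemma next_in_block_inj n (P Q : NC n) :
  next_in_block P =1 next_in_block Q -> P = Q.
Proof.
move=> PQ; apply: val_inj => /=.
rewrite -[NC_blocks P](equivalence_partition_pblock (NC_partition P)).
rewrite -[NC_blocks Q](equivalence_partition_pblock (NC_partition Q)).
apply: eq_imset => x; apply/setP => y; rewrite !inE /=.
rewrite !mem_pblockE; try exact: NC_partition.
by apply/eqP/eqP; apply: eq_block_next => //; exact: NC_partition.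
Qed.

Lemma NC_crossing n (P : NC n) (i j k l : 'I_n) : i < j -> j < k -> k < l ->
  pblock P i = pblock P k -> pblock P j = pblock P l -> pblock P i = pblock P j.
Proof.
move=> ij jk kl eik ejl.
have cP x : pblock P x \in (P : {set {set 'I_n}}).
  by apply: pblock_mem; rewrite (cover_partition (NC_partition P)) inE.
apply: (noncrossingP _ (NC_noncrossing P) i j k l) => //.
- exact: pblock_mem_self (NC_partition P) _.
- by rewrite eik; exact: pblock_mem_self (NC_partition P) _.
- exact: pblock_mem_self (NC_partition P) _.
- by rewrite ejl; exact: pblock_mem_self (NC_partition P) _.
Qed.

(** * The maps on partitions in terms of successors *)

Lemma same_region_pblock n (P : NC n) (i j : 'I_n) :
  (pblock (Kre P) i == pblock (Kre P) j) = same_region P i j.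
Proof.
rewrite -(mem_pblockE (NC_partition (Kre P))) pblock_equivalence_partition ?inE //.
by move=> x y z _ _ _; exact: same_region_equiv.
Qed.

Lemma SU_pblock n (P : NC n) (i j : 'I_n) :
  (pblock (SU P) i == pblock (SU P) j) =
  (pblock (Kre P) (rev_ord i) == pblock (Kre P) (rev_ord j)).
Proof.
rewrite same_region_pblock -(mem_pblockE (NC_partition (SU P))).
rewrite pblock_equivalence_partition ?inE //.
by move=> x y z _ _ _; exact: same_region_equiv.
Qed.

Lemma Rot_pblock n (P : NC n) (i j : 'I_n) :
  (pblock (Rot P) i == pblock (Rot P) j) =
  (pblock P (ordS i) == pblock P (ordS j)).
Proof.
have pP := NC_partition P; have pR := NC_partition (Rot P).
rewrite -(mem_pblockE pR) -(mem_pblockE pP).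
have mem (X : {set 'I_n}) (x : 'I_n) :
    (x \in [set ord_pred y | y in X]) = (ordS x \in X).
  by rewrite -{1}(ordSK x) mem_imset //; exact: ord_pred_inj.
rewrite (@mem_block _ (Rot P) pR [set ord_pred y | y in pblock P (ordS i)]) ?mem //.
  apply: imset_f; apply: pblock_mem; rewrite (cover_partition pP) inE //.
exact: pblock_mem_self.
Qed.

Lemma val_ordS n (i : 'I_n) :
  (i.+1 < n /\ ordS i = i.+1 :> nat) \/ (i.+1 = n /\ ordS i = 0 :> nat).
Proof.
have [in_|ni] := ltnP i.+1 n; first by left; rewrite /= modn_small.
have e : i.+1 = n by have := ltn_ord i; lia.
by right; split=> //; rewrite /= [X in X %% _]e modnn.
Qed.

Lemma ltn_addb (a b x : nat) :
  (a < x) (+) (b < x) = ((a < x) && (x <= b)) || ((b < x) && (x <= a)).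
Proof. by case: (ltnP a x); case: (ltnP b x). Qed.

(** As permutations, the Kreweras complement is the long cycle followed by the
    inverse of the partition.  The point i' and the prime of the predecessor j of
    i + 1 are not separated, since a block separating them would cross the chord
    from j to i + 1; and this chord separates i' from every k' strictly between
    i' and j'. *)
Lemma next_Kre n (P : NC n) (i : 'I_n) :
  next_in_block (Kre P) i = prev_in_block P (ordS i).
Proof.
have pP := NC_partition P; have pK := NC_partition (Kre P).
set j := prev_in_block P _.
have nj : next_in_block P j = ordS i by apply: prev_in_blockK.
have ej : pblock P j = pblock P (ordS i) by rewrite -nj pblock_next.
have ltP (B : {set 'I_n}) x : B \in NC_blocks P -> x \in B -> pblock P x = B.
  exact: mem_block.
have ci := val_ordS i; move: nj ej ci; set c := ordS i => nj ej ci.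
have nb k : pblock P j = pblock P k -> ~~ cyc_between j k c.
  by rewrite -nj; exact: next_in_block_between.
have ii := ltn_ord i; have jj := ltn_ord j.
apply: next_in_blockP => //.
  apply/eqP; rewrite same_region_pblock; apply/same_regionP => B BP.
  suff H x y : x \in B -> y \in B -> (i < x) (+) (j < x) -> (i < y) (+) (j < y).
    by move=> x y xB yB; apply/idP/idP; exact: H.
  rewrite !ltn_addb => xB yB Hx.
  have [xC|xC] := eqVneq (pblock P x) (pblock P j).
    have := nb x (esym xC); have := nb y; rewrite -xC (ltP _ _ BP xB) (ltP _ _ BP yB).
    move=> /(_ erefl); rewrite /cyc_between; move: Hx ci; have := ltn_ord x.
    have := ltn_ord y; lia.
  have xy : pblock P x = pblock P y by rewrite (ltP _ _ BP xB) (ltP _ _ BP yB).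
  apply/negPn/negP => Hy.
  have ne (z t : 'I_n) : pblock P z <> pblock P t -> z <> t :> nat.
    by move=> zt /val_inj e; apply: zt; rewrite e.
  have xj : x <> j :> nat by apply: ne => e; rewrite e eqxx in xC.
  have xc : x <> c :> nat by apply: ne => e; rewrite e ej eqxx in xC.
  have yj : y <> j :> nat by apply: ne => e; rewrite xy e eqxx in xC.
  have yc : y <> c :> nat by apply: ne => e; rewrite xy e ej eqxx in xC.
  have N1 : ~ (j < x /\ x < c /\ c < y).
    case=> a [b d]; have := NC_crossing a b d ej xy => e.
    by rewrite e eqxx in xC.
  have N2 : ~ (y < j /\ j < x /\ x < c).
    case=> a [b d]; have := NC_crossing a b d (esym xy) ej => e.
    by rewrite xy e eqxx in xC.
  have N3 : ~ (y < c /\ c < x /\ x < j).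
    case=> a [b d]; have := NC_crossing a b d (esym xy) (esym ej) => e.
    by rewrite xy e ej eqxx in xC.
  have N4 : ~ (c < x /\ x < j /\ j < y).
    case=> a [b d]; have := NC_crossing a b d (esym ej) xy => e.
    by rewrite ej e eqxx in xC.
  have N5 : ~ (c < y /\ y < j /\ j < x).
    case=> a [b d]; have := NC_crossing a b d (esym ej) (esym xy) => e.
    by rewrite ej e xy eqxx in xC.
  have := ltn_ord x; have := ltn_ord y; move: Hx Hy ci; lia.
move=> k /eqP; rewrite same_region_pblock => /same_regionP H.
have cP : pblock P c \in NC_blocks P.
  by apply: pblock_mem; rewrite (cover_partition pP) inE.
have jC : j \in pblock P c by rewrite -ej; exact: pblock_mem_self.
have := H _ cP _ _ (pblock_mem_self pP c) jC; rewrite !ltn_addb.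
by rewrite /cyc_between; have := ltn_ord k; have := ltn_ord c; lia.
Qed.

Lemma prev_Kre n (P : NC n) (i : 'I_n) :
  ordS (prev_in_block (Kre P) i) = next_in_block P i.
Proof.
apply/esym/eqP; rewrite -prev_in_blockP -?next_Kre ?prev_in_blockK //.
all: exact: NC_partition.
Qed.

Lemma cyc_between_ordS n (i k j : 'I_n) :
  cyc_between (ordS i) (ordS k) (ordS j) = cyc_between i k j.
Proof.
rewrite /cyc_between; have := val_ordS i; have := val_ordS k; have := val_ordS j.
have := ltn_ord i; have := ltn_ord k; have := ltn_ord j; lia.
Qed.

Lemma next_Rot n (P : NC n) (i : 'I_n) :
  ordS (next_in_block (Rot P) i) = next_in_block P (ordS i).
Proof.
have pP := NC_partition P; have pR := NC_partition (Rot P).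
rewrite -[RHS]ord_predK; congr ordS; apply: next_in_blockP => //.
  by apply/eqP; rewrite Rot_pblock ord_predK pblock_next.
move=> k /eqP; rewrite Rot_pblock => /eqP ik.
by rewrite -cyc_between_ordS ord_predK; exact: next_in_block_between.
Qed.

Lemma next_SU n (P : NC n) (i : 'I_n) :
  rev_ord (next_in_block (SU P) i) = prev_in_block (Kre P) (rev_ord i).
Proof.
have pK := NC_partition (Kre P); have pS := NC_partition (SU P).
rewrite -[RHS]rev_ordK; congr rev_ord; apply: next_in_blockP => //.
  by apply/eqP; rewrite SU_pblock rev_ordK pblock_prev.
move=> k /eqP; rewrite SU_pblock => /eqP ik.
have := @next_in_block_between _ _ pK (prev_in_block (Kre P) (rev_ord i)) (rev_ord k).
rewrite pblock_prev // prev_in_blockK // => /(_ ik).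
move: (prev_in_block _ _) => j; apply: contra; rewrite /cyc_between /=.
have := ltn_ord i; have := ltn_ord k; have := ltn_ord j.
lia.
Qed.

Lemma Rot_Kre n (P : NC n) : Rot P = Kre (Kre P).
Proof.
apply: next_in_block_inj => i; apply: ordS_inj.
by rewrite next_Rot next_Kre prev_Kre.
Qed.

(** * The matching of a non-crossing partition *)

Section Arc.
Variables (n : nat) (P : NC n).
Let pP := NC_partition P.
Implicit Types m : 'I_n.*2.

Definition arc m : 'I_n.*2 := Ordinal (arc_end_lt P m).

Lemma odd_arc m : odd (arc m) = ~~ odd m.
Proof. by rewrite /= /arc_end; case: (odd m); rewrite /= odd_double. Qed.

Lemma half_arc m : half_ord (arc m) =
  if odd m then next_in_block P (half_ord m) else prev_in_block P (half_ord m).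
Proof.
apply: val_inj; rewrite /= /arc_end; case: (odd m); first by rewrite doubleK.
by rewrite -uphalfE uphalf_double.
Qed.

Lemma arc_half m : arc m =
  (if odd m then next_in_block P (half_ord m) else prev_in_block P (half_ord m)).*2
  + ~~ odd m :> nat.
Proof. by rewrite /= /arc_end; case: (odd m); rewrite /= (addn0, addn1). Qed.

Lemma arc_odd m : odd m -> arc m = (next_in_block P (half_ord m)).*2 :> nat.
Proof. by rewrite arc_half => ->; rewrite addn0. Qed.

Lemma arc_even m :
  ~~ odd m -> arc m = (prev_in_block P (half_ord m)).*2.+1 :> nat.
Proof. by rewrite arc_half => /negbTE ->; rewrite addn1. Qed.

Lemma arcK : involutive arc.
Proof.
move=> m; apply: val_inj.
rewrite [LHS]arc_half odd_arc half_arc negbK -[RHS]odd_double_half addnC.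
congr (_ + _); congr _.*2; case: (odd m) => /=.
  by rewrite next_in_blockK.
by rewrite prev_in_blockK.
Qed.

Lemma arc_neq m : arc m <> m :> nat.
Proof. by move=> e; have := odd_arc m; rewrite e; case: odd. Qed.

Lemma pblock_half_arc m : pblock P (half_ord (arc m)) = pblock P (half_ord m).
Proof. by rewrite half_arc; case: odd; rewrite ?pblock_next ?pblock_prev. Qed.

Lemma nth_theta m : nth false (theta P) m = (m < arc m).
Proof. by rewrite -[nth _ _ _](tnth_nth false (theta_word P) m) tnth_mktuple. Qed.

(** Each letter R in a prefix closes the arc of an earlier letter U. *)
Lemma ht_theta k : k <= n.*2 ->
  ht (theta P) k + #|[set m : 'I_n.*2 | (m < k) && (arc m < m)]| =
  #|[set m : 'I_n.*2 | (m < k) && (m < arc m)]|.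
Proof.
move=> kn; have e (b : bool) (X : {set 'I_n.*2}) :
    X = [set m : 'I_n.*2 | (m < k) && (tnth (theta_word P) m == b)] ->
    #|X| = if b then ups (theta P) k else k - ups (theta P) k.
  move=> ->; rewrite -count_take_tuple //; case: b; first exact: count_take_true.
  by apply: count_take_false; rewrite size_tuple.
rewrite (e false _ _) ?(e true _ _).
- have := ups_ht (theta P) kn; have := count_size id (take k (theta P)).
  rewrite size_takel ?size_tuple // -/(ups _ _). lia.
- by apply/setP => m; rewrite !inE tnth_mktuple eqb_id.
- apply/setP => m; rewrite !inE tnth_mktuple eqbF_neg -leqNgt.
  by congr (_ && _); have := @arc_neq m; rewrite /=; lia.
Qed.

Lemma arc_inj : injective arc. Proof. exact: inv_inj arcK. Qed.

(** A prefix that contains both ends of each of its arcs has as many letters U as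
    letters R. *)
Lemma ht_theta_closed k : k <= n.*2 -> (forall m, m < k -> arc m < k) ->
  ht (theta P) k = 0.
Proof.
move=> kn cl; have := ht_theta kn.
rewrite -(card_imset _ arc_inj) (_ : _ @: _ = [set m : 'I_n.*2 | (m < k) && (m < arc m)]).
  by lia.
apply/setP => m; rewrite inE; apply/imsetP/idP => [[m'] | /andP[mk lt]].
  by rewrite inE => /andP[mk lt] ->; rewrite arcK cl.
by exists (arc m); rewrite ?inE ?arcK // cl.
Qed.

(** The arc that leaves the prefix gives a letter U that no letter R of the prefix
    closes. *)
Lemma ht_theta_pos k (m0 : 'I_n.*2) : k <= n.*2 -> m0 < k -> k <= arc m0 ->
  0 < ht (theta P) k.
Proof.
move=> kn mk km; have := ht_theta kn; rewrite -(card_imset _ arc_inj).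
set X := _ @: _; suff : #|X| < #|[set m : 'I_n.*2 | (m < k) && (m < arc m)]| by lia.
apply/proper_card/properP; split.
  apply/subsetP => m /imsetP[m']; rewrite inE => /andP[mk' lt] ->.
  by rewrite inE arcK lt (ltn_trans lt mk').
exists m0; first by rewrite inE mk (leq_trans mk km).
apply/imsetP => -[m]; rewrite inE => /andP[mk' lt] e.
by move: km; rewrite e arcK; lia.
Qed.

(** The arc of the first point ends at the prime of the last element of the block
    of 1; as no block crosses that one, the points before this end are matched
    among themselves. *)
Lemma arc0_closed (m0 m : 'I_n.*2) : m0 = 0 :> nat -> m < (arc m0).+1 ->
  arc m < (arc m0).+1.
Proof.
move=> m00; set j := prev_in_block P (half_ord m0).
have h0 : half_ord m0 = 0 :> nat by rewrite /= m00.
have cj k : pblock P k = pblock P (half_ord m0) -> k <= j.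
  move=> ek; have := @next_in_block_between _ _ pP j k.
  rewrite prev_in_blockK // pblock_prev // ek => /(_ erefl).
  by rewrite /cyc_between h0; lia.
have a0 : arc m0 = j.*2.+1 :> nat by rewrite arc_half m00 /= addn1.
have ej : pblock P j = pblock P (half_ord m0) by exact: pblock_prev.
clearbody j; rewrite !ltnS a0 => mj; rewrite leqNgt; apply/negP => lt.
have eb := pblock_half_arc m.
have halfE (x : 'I_n.*2) : half_ord x = x./2 :> nat by [].
have hm : half_ord m <= j by rewrite halfE; lia.
have ha : j < half_ord (arc m) by rewrite halfE; lia.
have ne : pblock P (half_ord m) <> pblock P (half_ord m0).
  by rewrite -eb => /cj; lia.
have m0m : half_ord m0 < half_ord m.
  rewrite h0 lt0n; apply/negP => /eqP e; apply: ne; congr pblock.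
  by apply: val_inj; exact: etrans e (esym h0).
have mj' : half_ord m < j.
  rewrite ltn_neqAle hm andbT; apply/negP => /eqP/val_inj e; apply: ne.
  by rewrite e.
by apply: ne; rewrite -(NC_crossing m0m mj' ha).
Qed.

End Arc.

Section Promotion.
Variable n : nat.
Hypothesis n_gt0 : 0 < n.
Implicit Types P Q : NC n.

Let N0 : 0 < n.*2. Proof. by rewrite double_gt0. Qed.
Let m0 : 'I_n.*2 := Ordinal N0.

Definition first_return (h : nat -> nat) (r : nat) : Prop :=
  h r = 0 /\ forall k, 0 < k < r -> 0 < h k.

Lemma first_return_theta P : first_return (ht (theta P)) (arc P m0).+1.
Proof.
have a0 := ltn_ord (arc P m0); split.
  by apply: ht_theta_closed => // m; exact: arc0_closed.
move=> k /andP[k0 ka]; apply: (@ht_theta_pos _ P k m0) => //; lia.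
Qed.

Lemma first_return_uniq h r r' :
  0 < r -> 0 < r' -> first_return h r -> first_return h r' -> r = r'.
Proof.
move=> r0 r0' [hr Hr] [hr' Hr']; have := Hr r'; have := Hr' r; lia.
Qed.

(** The first letter is matched with the letter of the first return, so leaving
    it out lowers the cut before this return and raises it afterwards. *)
Lemma cut1_first_return (D : dyck n) r j :
  first_return (ht D) r -> 0 < r -> j < n.*2 ->
  ht D j.+1 + (r <= j.+1) = cut (ht D) 1 j.+1 + (j.+1 < r).
Proof.
case=> hr Hr r0 jn; have h1 : ht D 1 = 1.
  by have := unit_steps_ht D N0; rewrite ht0; lia.
have /(_ isT) := @cut_rmin (ht D) 1 j.+1; rewrite h1 subn1 /=.
have [rj|jr] := leqP r j.+1.
  have : rmin (ht D) 1 j <= ht D r by apply: rmin_le; lia.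
  by rewrite hr; lia.
suff -> : rmin (ht D) 1 j = 1 by lia.
apply/anti_leq/andP; split; first by rewrite -[X in _ <= X]h1 rmin_le.
elim: j jr {jn} => [|j IH] jr; first by rewrite /= h1.
by rewrite /= leq_min IH ?Hr //; lia.
Qed.

(** In terms of words, both maps send U A R B, where the letter R is the end of the
    first arc, to A U B R. *)
Lemma theta_promotion P Q :
  (forall m, ordS (arc Q m) = arc P (ordS m)) -> theta Q = promotion (theta P).
Proof.
move=> PQ; have fr := first_return_theta P.
set D := theta P in fr *; pose r := (arc P m0).+1.
have rn : r <= n.*2 by exact: ltn_ord.
apply/val_inj/val_inj/(@eq_from_nth _ false); first by rewrite !size_tuple.
rewrite size_tuple => k kn.
rewrite -[LHS]/(nth false (theta Q) k) -[RHS]/(nth false (promotion D) k).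
have := nth_theta Q (Ordinal kn).
rewrite [nat_of_ord (Ordinal kn)]/= => ->.
rewrite ht_letter //; have := PQ (Ordinal kn).
set q := arc Q _; have := val_ordS (Ordinal kn); rewrite [nat_of_ord (Ordinal _)]/=.
have qk : q <> k :> nat by exact: (arc_neq (m := Ordinal kn)).
case=> [[kn' e1]|[kn' e1]] eq; last first.
  rewrite kn' ht_end ltn0; have := ltn_ord q; lia.
have {}eq : nat_of_ord (ordS q) = arc P (ordS (Ordinal kn)) by rewrite eq.
rewrite !ht_promotion //; move: eq.
have := nth_theta P (ordS (Ordinal kn)); have := ht_letter D kn'.
rewrite e1 => -> lt; have := cut1_first_return fr (ltn0Sn _) kn.
have := cut1_first_return fr (ltn0Sn _) kn'.
have := @unit_steps_ht _ D k.+1 kn'.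
have := val_ordS q; have := ltn_ord q; have := ltn_ord (arc P (ordS (Ordinal kn))).
have e0 : arc P (ordS (Ordinal kn)) = 0 :> nat <-> k.+2 = r.
  rewrite /r; split=> e.
    suff -> : arc P m0 = ordS (Ordinal kn) by rewrite e1.
    by rewrite -[RHS](@arcK _ P); congr (arc P _); apply: val_inj; symmetry; exact: e.
  have -> : ordS (Ordinal kn) = arc P m0 by apply: ord_inj; rewrite e1; lia.
  by rewrite arcK.
move: lt e0; rewrite -/r; move: (arc P _) => a; lia.
Qed.

(** The arc of the new point i' is the old arc of i + 1, by [next_Kre]. *)
Lemma arc_Kre P m : ordS (arc (Kre P) m) = arc P (ordS m).
Proof.
apply: val_inj.
have mn := ltn_ord m; have Sm := val_ordS m; have odm := odd_double_half m.
have hn := ltn_ord (half_ord m).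
have So : odd (ordS m) = ~~ odd m.
  case: Sm => -[mE ->] //; have : odd m.+1 = false by rewrite mE odd_double.
  by rewrite oddS => /negbFE ->.
rewrite -[LHS]/(nat_of_ord (ordS (arc (Kre P) m))) -[RHS]/(nat_of_ord (arc P (ordS m))).
have := val_ordS (arc (Kre P) m).
have halfE (x : 'I_n.*2) : half_ord x = x./2 :> nat by [].
case: (boolP (odd m)) => om.
  rewrite (@arc_even _ P (ordS m)) ?So ?om //.
  have -> : half_ord (ordS m) = ordS (half_ord m).
    apply: ord_inj; rewrite halfE.
    by have := val_ordS (half_ord m); rewrite halfE; rewrite om in odm; lia.
  rewrite -next_Kre (arc_odd _ om); move: (next_in_block _ _) (ordS _) => a b.
  by have := ltn_ord a; lia.
rewrite (@arc_odd _ P (ordS m)) ?So // (arc_even _ om).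
have -> : half_ord (ordS m) = half_ord m.
  by apply: ord_inj; rewrite !halfE; lia.
rewrite -prev_Kre; have := val_ordS (prev_in_block (Kre P) (half_ord m)).
move: (prev_in_block _ _) (ordS (arc _ _)) => a b.
by have := ltn_ord a; move: (ordS a) => c; lia.
Qed.

Lemma theta_Kre P : theta (Kre P) = promotion (theta P).
Proof. exact/theta_promotion/arc_Kre. Qed.

(** Equal words have equal first returns, hence equal arcs at their first
    letters; turning the matchings with Kre gives the other arcs. *)
Lemma theta_arc_inj P Q : theta P = theta Q -> arc P =1 arc Q.
Proof.
move=> PQ [m mn]; elim: m mn P Q PQ => [|m IH] mn P Q PQ.
  have := first_return_theta P; have := first_return_theta Q; rewrite PQ => f1 f2.
  have e := first_return_uniq (ltn0Sn _) (ltn0Sn _) f2 f1.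
  rewrite (_ : Ordinal mn = m0); last exact: val_inj.
  by apply: ord_inj; exact: succn_inj e.
have -> : Ordinal mn = ordS (Ordinal (ltnW mn)).
  by apply: ord_inj; have [[_ ->]|[/= e _]] := val_ordS (Ordinal (ltnW mn)) => //=; lia.
by rewrite -!arc_Kre (IH _ (Kre P) (Kre Q)) // !theta_Kre PQ.
Qed.

Lemma theta_inj : injective (@theta n).
Proof.
move=> P Q /theta_arc_inj PQ; apply: next_in_block_inj => i.
have iP : i.*2.+1 < n.*2 by have := ltn_ord i; lia.
have := congr1 (@nat_of_ord _) (PQ (Ordinal iP)).
have hi : half_ord (Ordinal iP) = i by apply: ord_inj; rewrite /= uphalf_double.
by rewrite !arc_odd ?hi /= ?odd_double // => /double_inj; exact: ord_inj.
Qed.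

(** SU places its labels where Kre does, but in the opposite direction. *)
Lemma arc_SU P m : rev_ord (arc (SU P) m) = arc (Kre P) (rev_ord m).
Proof.
have halfE (x : 'I_n.*2) : half_ord x = x./2 :> nat by [].
have revE N (x : 'I_N) : rev_ord x = N - x.+1 :> nat by [].
have orev : odd (rev_ord m) = ~~ odd m by rewrite revE; have := ltn_ord m; lia.
have hrev : half_ord (rev_ord m) = rev_ord (half_ord m).
  by apply: ord_inj; rewrite halfE !revE halfE; have := ltn_ord m; lia.
apply: ord_inj; rewrite revE; case: (boolP (odd m)) => om.
  rewrite (arc_odd _ om) (@arc_even _ _ (rev_ord m)) ?orev ?om // hrev -next_SU revE.
  by have := ltn_ord (next_in_block (SU P) (half_ord m)); lia.
rewrite (arc_even _ om) (@arc_odd _ _ (rev_ord m)) ?orev // hrev.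
have -> : next_in_block (Kre P) (rev_ord (half_ord m)) =
    rev_ord (prev_in_block (SU P) (half_ord m)).
  apply/eqP; rewrite -prev_in_blockP; last exact: NC_partition.
  by rewrite -next_SU prev_in_blockK //; exact: NC_partition.
by rewrite revE; have := ltn_ord (prev_in_block (SU P) (half_ord m)); lia.
Qed.

Lemma theta_SU P : theta (SU P) = evacuation (promotion (theta P)).
Proof.
rewrite -theta_Kre; set Q := Kre P.
apply/val_inj/val_inj/(@eq_from_nth _ false); first by rewrite !size_tuple.
rewrite size_tuple => k kn.
rewrite -[LHS]/(nth false (theta (SU P)) k) -[RHS]/(nth false (evacuation (theta Q)) k).
have := nth_theta (SU P) (Ordinal kn); rewrite [nat_of_ord (Ordinal kn)]/= => ->.
rewrite ht_letter // !ht_evacuation //; last exact: ltnW.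
have k'n : n.*2 - k.+1 < n.*2 by lia.
have := htS (theta Q) k'n; have := nth_theta Q (rev_ord (Ordinal kn)).
have := @arc_neq _ Q (rev_ord (Ordinal kn)); rewrite -arc_SU.
rewrite (_ : (n.*2 - k.+1).+1 = n.*2 - k); last lia.
rewrite -[nat_of_ord (rev_ord (Ordinal kn))]/(n.*2 - k.+1).
rewrite -[nat_of_ord (rev_ord (arc _ _))]/(n.*2 - (arc (SU P) (Ordinal kn)).+1).
move: (arc _ _) => a /eqP ne ->.
by have := ltn_ord a; case: ifP; lia.
Qed.

End Promotion.

(** * The zigzag in the growth diagram *)

(** The zigzag follows the antidiagonal of the growth diagram; one letter at the
    right end and one letter at the left end of the interval are left out in
    turn.  Each of them changes the cut by 1 or -1: x i counts the increases among
    the first i letters on the right, y i the decreases among the first i letters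
    on the left. *)
Definition zigzag n (x y : nat -> nat) (D : dyck n) : Prop :=
  forall i, i < n ->
    cut (ht D) i (n.*2 - i) + (y i).*2 = (x i).*2 /\
    cut (ht D) i (n.*2 - i.+1) + (y i).*2 + 1 = (x i.+1).*2.

(** The local rule, read from the zigzag outwards, recovers the first row of the
    growth diagram. *)
Lemma zigzag_inj n x y (D D' : dyck n) : zigzag x y D -> zigzag x y D' -> D = D'.
Proof.
move=> zD zD'; have hS := unit_steps_ht D; have hS' := unit_steps_ht D'.
have H s a b : a <= b -> a + b + s = n.*2 -> cut (ht D) a b = cut (ht D') a b.
  have [m] := ubnP s; elim: m s a b => // m IH s a b sm ab abs.
  have [->|ab'] := eqVneq a b; first by rewrite !cutxx.
  have an : a < n by lia.
  have [e1 e2] := zD a an; have [e1' e2'] := zD' a an.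
  case: s abs sm => [|[|s]] abs sm.
  - by rewrite (_ : b = n.*2 - a); lia.
  - by rewrite (_ : b = n.*2 - a.+1); lia.
  rewrite (cut_local_inv hS) 1?[RHS](cut_local_inv hS'); try lia.
  by rewrite (IH s.+1 a.+1) ?(IH s.+1 a b.+1) ?(IH s a.+1 b.+1) //; lia.
apply: dyck_ht_inj => k kn.
by rewrite -[LHS]cut_from0 -[RHS]cut_from0 (H (n.*2 - k)) //; lia.
Qed.

(** The zigzags of the evacuation of D and of its promotion share every other
    entry.  The remaining entries are opposite corners of squares of the growth
    diagram of D, hence exchanged by the local rule; this exchanges the increases
    of one zigzag with the decreases of the other, shifted by one. *)
Lemma zigzag_evacuation n (x y x' y' : nat -> nat) (D : dyck n) :
    x' 0 = 0 -> y' 0 = 0 -> (forall i, y i <= y i.+1) ->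
    (forall i, i < n -> x i.+1 + y' i = i.+1 /\ y i + x' i.+1 = i.+1) ->
  zigzag x y (promotion D) -> zigzag x' y' (evacuation D).
Proof.
move=> x0 y0 ymono xy zD i in_; have n0 : 0 < n by exact: leq_ltn_trans in_.
have [xi yi] := xy i in_; have [_ z1] := zD i in_.
have eN j : j < n -> (n.*2 - j.+1).+1 = n.*2 - j by lia.
have NK j : j <= n -> n.*2 - (n.*2 - j) = j by lia.
have in1 : i <= n.*2 - i by lia.
have in2 : i <= n.*2 - i.+1 by lia.
have in3 : n.*2 - i.+1 < n.*2 by lia.
rewrite !cut_evacuation ?leq_subr // !NK ?(ltnW in_) //.
move: z1; rewrite cut_promotion // eN // => z1; split; last first.
  by clear -z1 xi yi; lia.
case: i in_ xi yi z1 in1 in2 in3 => [|i] in_ xi yi z1 in1 in2 in3.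
  by rewrite subn0 cut_from0 ht_end x0 y0.
have [xi' yi'] := xy i (ltnW in_); have [_ z2] := zD i (ltnW in_).
have [z3 _] := zD i.+1 in_.
have in4 : n.*2 - i.+1 < n.*2 by lia.
have in5 : i.+1 < n.*2 - i.+1 by lia.
have in6 : i <= n.*2 - i.+1 by lia.
rewrite (cut_promotion _ in6 in4) (eN _ (ltnW in_)) in z2.
rewrite (cut_promotion _ (ltnW in5) in4) (eN _ (ltnW in_)) in z3.
have := cut_local_inv (unit_steps_ht D) in5 in4; rewrite eN ?(ltnW in_) //.
have := ymono i; rewrite /flip; clear -xi yi xi' yi' z1 z2 z3; lia.
Qed.

(** * Peaks and valleys *)

Lemma vertex_rcons s c k : k <= size s -> vertex (rcons s c) k = vertex s k.
Proof. by move=> ks; rewrite /vertex -cats1 takel_cat. Qed.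

Lemma corners_rcons a b s c x : s = x :: behead s ->
  corners a b (rcons s c) =
  corners a b s ++ (if (last x s == a) && (c == b)
                    then [:: vertex s (size s)] else [::]).
Proof.
move=> sx; have s0 : 0 < size s by rewrite sx.
rewrite /corners size_rcons -[in LHS](prednK s0) -pred_Sn iota1S.
rewrite filter_rcons prednK // /= nth_rcons ltn_predL s0 nth_last.
rewrite nth_rcons ltnn eqxx (_ : last false s = last x s); last by rewrite sx.
have -> : [seq k <- iota 1 (size s).-1 | (nth false (rcons s c) k.-1 == a)
                                    & (nth false (rcons s c) k == b)]
        = [seq k <- iota 1 (size s).-1 | (nth false s k.-1 == a) & (nth false s k == b)].
  apply: eq_in_filter => k; rewrite mem_iota => /andP[k1 ks].
  by rewrite !nth_rcons !ifT //; lia.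
set L := [seq k <- _ | _]; have HL : {in L, vertex (rcons s c) =1 vertex s}.
  move=> k; rewrite mem_filter mem_iota => /and3P[_ k1 ks].
  by apply: vertex_rcons; lia.
case: ifP => _; last by rewrite cats0; exact/eq_in_map.
by rewrite map_rcons vertex_rcons // cats1; congr rcons; exact/eq_in_map.
Qed.

Lemma mem_corners a b s v :
  reflect (exists k, [/\ 0 < k < size s, nth false s k.-1 = a,
                         nth false s k = b & v = vertex s k])
          (v \in corners a b s).
Proof.
apply: (iffP mapP) => [[k] | [k [ks /eqP ka /eqP kb ->]]].
  rewrite mem_filter mem_iota => /andP[/andP[/eqP ka /eqP kb] ks] ->.
  by exists k; split=> //; lia.
by exists k; rewrite // mem_filter ka kb mem_iota /=; lia.
Qed.

Lemma vertex_sum s k : k <= size s -> (vertex s k).1 + (vertex s k).2 = k.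
Proof.
move=> ks; rewrite /= count_take_false // count_take_true subnK //.
by have := count_size id (take k s); rewrite size_takel.
Qed.

Lemma vertex_inj s t j k : j <= size s -> k <= size t ->
  vertex s j = vertex t k -> j = k.
Proof. by move=> js kt e; rewrite -(vertex_sum js) e vertex_sum. Qed.

Lemma vertex_end s :
  vertex s (size s) = (count_mem false s, count_mem true s).
Proof. by rewrite /vertex take_size. Qed.

(** Peaks and valleys alternate, and between two of them only one coordinate
    changes. *)
Lemma peaks_valleys s : s = true :: behead s ->
  if last true s then
    unzip2 (peaks s) = unzip2 (valleys s) /\
    rcons (unzip1 (peaks s)) (count_mem false s) = 0 :: unzip1 (valleys s)
  else
    unzip1 (peaks s) = 0 :: unzip1 (valleys s) /\
    unzip2 (peaks s) = rcons (unzip2 (valleys s)) (count_mem true s).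
Proof.
elim/last_ind: s => // s c IH.
have [-> | s0] := eqVneq s [::]; first by case: c {IH}.
move=> sx; have {}sx : s = true :: behead s by case: s s0 sx {IH} => //= x s _ [->].
have {s0} := IH sx; move: (behead s) sx => s' {IH} ->; set t := true :: s' => IH.
rewrite /peaks /valleys !(@corners_rcons _ _ t c true) // -/(peaks t) -/(valleys t).
rewrite vertex_end last_rcons -!(cats1 t) !count_cat.
move: (last true t) (count_mem false t) (count_mem true t) (peaks t) (valleys t) IH.
move=> l cx cy p v; rewrite /unzip1 /unzip2 !map_cat.
by case: l => -[e1 e2]; case: c; rewrite /= ?cats0 ?addn0 ?e1 ?e2 ?cats1 ?e2.
Qed.

Lemma sorted_peaks s : s = true :: behead s ->
  pairwise ltn (rcons (unzip1 (peaks s)) (count_mem false s)) /\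
  pairwise ltn (if last true s then rcons (unzip2 (peaks s)) (count_mem true s)
                else unzip2 (peaks s)).
Proof.
elim/last_ind: s => // s c IH.
have [-> | s0] := eqVneq s [::]; first by case: c {IH}.
move=> sx; have {}sx : s = true :: behead s by case: s s0 sx {IH} => //= x s _ [->].
have {s0} := IH sx; have := peaks_valleys sx.
move: (behead s) sx => s' {IH} ->; set t := true :: s' => PV IH.
move: PV IH; rewrite /peaks (@corners_rcons _ _ t c true) //.
rewrite vertex_end last_rcons -!(cats1 t) !count_cat -/(peaks t).
move: (last true t) (count_mem false t) (count_mem true t) (peaks t) (valleys t).
move=> l cx cy p v; rewrite /unzip1 /unzip2 !map_cat.
have all_leqS z (r : seq nat) : all (ltn^~ z) r -> all (ltn^~ z.+1) r.
  by apply: sub_all => y /= /ltnW.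
case: l => -[e1 e2] [];
  case: c; rewrite /= ?cats0 ?addn0 ?addn1 ?cats1 ?map_rcons !pairwise_rcons.
- by move=> -> /andP[/all_leqS -> ->].
- by move=> /andP[h ->] ->; rewrite all_rcons h (all_leqS _ _ h) /= ltnS leqnn.
- move=> -> h; rewrite h andbT; split=> //; move: h.
  by rewrite e2 all_rcons pairwise_rcons /= ltnS leqnn => /andP[/all_leqS ->].
- by move=> /andP[/all_leqS -> ->] ->.
Qed.

Lemma dyck_corners n (D : dyck n) : 0 < n ->
  [/\ D = true :: behead D :> seq bool,
      unzip1 (peaks D) = 0 :: unzip1 (valleys D),
      unzip2 (peaks D) = rcons (unzip2 (valleys D)) n,
      sorted ltn (unzip1 (peaks D)) & sorted ltn (unzip2 (peaks D))].
Proof.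
move=> n0; have N0 : 0 < n.*2 by rewrite double_gt0.
have [sz ct _] := dyckP D.
have D1 : D = true :: behead D :> seq bool.
  have := htS D N0; rewrite ht0; case: (tval D) sz => [|x s] /=; first by lia.
  by case: x => // _; lia.
have last0 : last true D = false.
  have := @htS _ D n.*2.-1; rewrite prednK // ht_end.
  have := nth_last false D; rewrite size_tuple => -> /(_ (leqnn _)).
  by rewrite D1 /=; case: last => //; lia.
have := peaks_valleys D1; have := sorted_peaks D1; rewrite last0.
have -> : count_mem true D = n.
  by rewrite -[tval D in LHS]take_size count_take_true sz.
rewrite !sorted_pairwise; try exact: ltn_trans.
by rewrite pairwise_rcons => -[/andP[_ ->] ->] [-> ->].
Qed.

Lemma peak_lt n (D : dyck n) v : v \in peaks D -> v.1 < v.2.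
Proof.
have [sz _ H] := dyckP D.
have {}H j : j <= size D -> j <= (ups D j).*2 by rewrite sz; exact: H.
move=> /mem_corners[k [/andP[k0 ks] ka _ ->]].
rewrite /= count_take_true count_take_false ?(ltnW ks) //.
have k1s : k.-1 < size D by rewrite prednK // ltnW.
have := upsS k1s; rewrite ka prednK //.
have := H _ (ltnW k1s); lia.
Qed.

Lemma valley_le n (D : dyck n) v : v \in valleys D -> v.1 <= v.2.
Proof.
have [sz _ H] := dyckP D.
have {}H j : j <= size D -> j <= (ups D j).*2 by rewrite sz; exact: H.
move=> /mem_corners[k [/andP[k0 ks] ka _ ->]].
rewrite /= count_take_true count_take_false ?(ltnW ks) //.
have := H _ (ltnW ks); lia.
Qed.

(** At the first difference one of the two paths has a corner where the other one
    goes straight on. *)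
Lemma corners_inj (s t : seq bool) : size s = size t ->
    s = true :: behead s -> t = true :: behead t ->
    peaks s =i peaks t -> valleys s =i valleys t -> s = t.
Proof.
move=> st s1 t1 P V.
have H k : k < size s -> nth false s k = nth false t k.
  elim: k => [|k IH] ks; first by rewrite s1 t1.
  have {}IH := IH (ltnW ks).
  (* A letter that differs from the previous one makes a corner. *)
  have step (s' t' : seq bool) : size s' = size s -> size t' = size s ->
      nth false s' k = nth false t' k -> peaks s' =i peaks t' ->
      valleys s' =i valleys t' ->
      nth false s' k.+1 = ~~ nth false s' k -> nth false t' k.+1 = ~~ nth false s' k.
    move=> ss ts e P' V' d.
    have : vertex s' k.+1 \in corners (nth false s' k) (~~ nth false s' k) s'.
      by apply/mem_corners; exists k.+1; rewrite ss ks d.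
    have -> : (vertex s' k.+1 \in corners (nth false s' k) (~~ nth false s' k) s') =
        (vertex s' k.+1 \in corners (nth false s' k) (~~ nth false s' k) t').
      by case: (nth false s' k); [exact: P' | exact: V'].
    move=> /mem_corners[j [/andP[j0 js] _ jb /vertex_inj ->]] //.
      by rewrite ss ltnW.
    exact: ltnW.
  have := step s t erefl (esym st) IH P V.
  have := step t s (esym st) erefl (esym IH) (fun v => esym (P v)) (fun v => esym (V v)).
  rewrite -IH; case: (nth _ s k); case: (nth _ s k.+1); case: (nth _ t k.+1) => // /= H1 H2;
    first [discriminate (H1 erefl) | discriminate (H2 erefl)].
exact: (@eq_from_nth _ false _ _ st H).
Qed.

Lemma sorted_unzip1_valleys n (D : dyck n) : 0 < n -> sorted ltn (unzip1 (valleys D)).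
Proof. by case/(dyck_corners D) => _ -> _ /path_sorted. Qed.

Lemma sorted_unzip2_valleys n (D : dyck n) : 0 < n -> sorted ltn (unzip2 (valleys D)).
Proof.
move=> /(dyck_corners D)[_ _ -> _]; rewrite !(sorted_pairwise ltn_trans).
by rewrite pairwise_rcons => /andP[].
Qed.

Lemma sorted_ltn_eq (s t : seq nat) : sorted ltn s -> sorted ltn t -> s =i t -> s = t.
Proof. by apply: irr_sorted_eq; [exact: ltn_trans | exact: ltnn]. Qed.

Lemma eq_unzip (S T : Type) (l l' : seq (S * T)) :
  unzip1 l = unzip1 l' -> unzip2 l = unzip2 l' -> l = l'.
Proof. by move=> e1 e2; rewrite -(zip_unzip l) -(zip_unzip l') e1 e2. Qed.

Lemma peaks_inj n (D D' : dyck n) : 0 < n -> perm_eq (peaks D) (peaks D') -> D = D'.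
Proof.
move=> n0 P; have [D1 x1 y1 sx sy] := dyck_corners D n0.
have [D1' x1' y1' sx' sy'] := dyck_corners D' n0.
have ex : unzip1 (peaks D) = unzip1 (peaks D').
  by apply: sorted_ltn_eq => //; apply: perm_mem; exact: perm_map.
have ey : unzip2 (peaks D) = unzip2 (peaks D').
  by apply: sorted_ltn_eq => //; apply: perm_mem; exact: perm_map.
apply/val_inj/val_inj/corners_inj => //; first by rewrite !size_tuple.
  exact: perm_mem.
move: ex ey; rewrite x1 x1' y1 y1' => -[ex] /rcons_inj[ey].
by rewrite -[val (val D)]/(tval D) -[val (val D')]/(tval D') (eq_unzip ex ey).
Qed.

Lemma valleys_inj n (D D' : dyck n) : 0 < n ->
  perm_eq (valleys D) (valleys D') -> D = D'.
Proof.
move=> n0 V; have [D1 x1 y1 _ _] := dyck_corners D n0.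
have [D1' x1' y1' _ _] := dyck_corners D' n0.
have ex : unzip1 (valleys D) = unzip1 (valleys D').
  by apply: sorted_ltn_eq; try exact: sorted_unzip1_valleys; apply: perm_mem; exact: perm_map.
have ey : unzip2 (valleys D) = unzip2 (valleys D').
  by apply: sorted_ltn_eq; try exact: sorted_unzip2_valleys; apply: perm_mem; exact: perm_map.
apply/val_inj/val_inj/corners_inj => //; first by rewrite !size_tuple.
  rewrite -[val (val D)]/(tval D) -[val (val D')]/(tval D').
  by rewrite (@eq_unzip _ _ (peaks D) (peaks D')) // ?x1 ?x1' ?y1 ?y1' ?ex ?ey.
exact: perm_mem.
Qed.

(** * 321-avoiding permutations *)

Lemma sum_ltn n m : m <= n -> \sum_(v < n) (v < m) = m.
Proof.
move=> mn; rewrite -[RHS]muln1 -[m in RHS]card_ord -sum_nat_const.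
rewrite (big_ord_widen n (fun=> 1)) // [RHS]big_mkcond.
by apply: eq_bigr => i _; case: ltnP.
Qed.

Lemma sum_perm_ltn n (w : 'S_n) m : m <= n -> \sum_(j < n) (w j < m) = m.
Proof.
move=> mn; rewrite -[RHS](sum_ltn mn) [RHS](reindex_perm w).
by apply: eq_bigr.
Qed.

Lemma sum_eq1 n (i : 'I_n) : \sum_(k < n) (k == i) = 1.
Proof.
rewrite (bigD1 i) //= eqxx big1 ?addn0 // => k /negbTE -> //.
Qed.

(** A 321-avoiding permutation is increasing on its weak excedances and on the
    other positions: a descent between two of them would extend to 321, to the
    right for weak excedances and to the left for the others, since there is not
    enough room on the other side. *)
Lemma av321_mono n (w : av321 n) (i j : 'I_n) :
  i < j -> (i <= w i) = (j <= w j) -> w i < w j.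
Proof.
move=> ij ee; have := valP w; rewrite /avoids321 => /existsP nav.
have {}nav (a b c : 'I_n) : a < b -> b < c -> w b < w a -> w c < w b -> False.
  move=> ab bc ba cb; apply: nav; exists a; apply/existsP; exists b.
  by apply/existsP; exists c; rewrite -!/(av321_perm w) ab bc ba cb.
rewrite ltnNge; apply/negP; rewrite leq_eqVlt => /orP[/eqP/val_inj/perm_inj e|ji].
  by rewrite e ltnn in ij.
have [ie|ie] := leqP i (w i).
  have je : j <= w j by rewrite -ee.
  case: (boolP [exists k : 'I_n, (j < k) && (w k < w j)]) => [/existsP[k /andP[jk kj]]|].
    exact: nav ij jk ji kj.
  rewrite negb_exists => /forallP H.
  have : \sum_(k < n) ((w k < w j) + (k == i)) <= \sum_(k < n) (k < j).
    apply: leq_sum => k _; have := H k; rewrite negb_and -!leqNgt.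
    have [->|ki] := eqVneq k i; first by rewrite ltnNge (ltnW ji) ij.
    have [kj|] := ltnP (w k) (w j) => //; rewrite orbF leq_eqVlt.
    by case/orP => [/eqP/val_inj e| -> //]; rewrite e ltnn in kj.
  rewrite big_split /= sum_perm_ltn ?sum_eq1 ?sum_ltn //; try exact: ltnW.
  by lia.
have je : w j < j by rewrite ltnNge -ee -ltnNge.
case: (boolP [exists k : 'I_n, (k < i) && (w i < w k)]) => [/existsP[k /andP[ki ik]]|].
  exact: nav ki ij ik ji.
rewrite negb_exists => /forallP H.
have : \sum_(k < n) (k < i) <= \sum_(k < n) (w k < w i).
  apply: leq_sum => k _; have := H k; rewrite negb_and -!leqNgt.
  case: ltnP => // ki /=; rewrite leq_eqVlt => /orP[/eqP/val_inj/perm_inj e| -> //].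
  by rewrite e ltnn in ki.
by rewrite sum_perm_ltn ?sum_ltn //; try exact: ltnW; lia.
Qed.

Definition exc_pos n (w : 'S_n) (k : nat) : nat := \sum_(j < n) ((j < k) && (j <= w j)).
Definition exc_val n (w : 'S_n) (k : nat) : nat := \sum_(j < n) ((w j < k) && (j <= w j)).

Section ExcCount.
Variables (n : nat) (w : 'S_n).

Lemma exc_pos0 : exc_pos w 0 = 0. Proof. by rewrite /exc_pos big1. Qed.
Lemma exc_val0 : exc_val w 0 = 0. Proof. by rewrite /exc_val big1. Qed.

Lemma exc_posS (i : 'I_n) : exc_pos w i.+1 = exc_pos w i + (i <= w i).
Proof.
have -> : exc_pos w i.+1 = exc_pos w i + \sum_(j < n) ((j == i) && (j <= w j)).
  rewrite -big_split; apply: eq_bigr => j _ /=; rewrite ltnS leq_eqVlt.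
  by rewrite (inj_eq val_inj); have [->|ne] := eqVneq j i; rewrite ?ltnn //= addn0.
congr (_ + _); rewrite (bigD1 i) //= eqxx big1 ?addn0 // => j /negbTE -> //.
Qed.

Lemma exc_valS (j : 'I_n) : exc_val w (w j).+1 = exc_val w (w j) + (j <= w j).
Proof.
have -> : exc_val w (w j).+1 = exc_val w (w j) + \sum_(k < n) ((k == j) && (k <= w k)).
  rewrite -big_split; apply: eq_bigr => k _ /=; rewrite ltnS leq_eqVlt.
  rewrite (inj_eq val_inj) (inj_eq perm_inj).
  by have [->|ne] := eqVneq k j; rewrite ?ltnn //= addn0.
congr (_ + _); rewrite (bigD1 j) //= eqxx big1 ?addn0 // => k /negbTE -> //.
Qed.

Lemma exc_val_mono a b : a <= b -> exc_val w a <= exc_val w b.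
Proof.
move=> ab; apply: leq_sum => j _; case: (j <= w j); rewrite ?andbF // !andbT.
by case: ltnP => // /leq_trans -> .
Qed.

Lemma exc_valB a b : a <= b -> b <= n -> exc_val w b - exc_val w a <= b - a.
Proof.
move=> ab bn; rewrite leq_subLR.
have an := leq_trans ab bn.
suff : exc_val w b + \sum_(j < n) (w j < a) <= exc_val w a + \sum_(j < n) (w j < b).
  by rewrite !sum_perm_ltn //; lia.
rewrite -!big_split; apply: leq_sum => j _ /=.
by case: (j <= w j); rewrite ?andbF ?andbT /=; have := ab; case: (ltnP (w j) a); case: (ltnP (w j) b); lia.
Qed.

Lemma exc_total : exc_pos w n = exc_val w n.
Proof. by apply: eq_bigr => j _; rewrite !ltn_ord. Qed.

End ExcCount.

(** By monotonicity, a weak excedance and its value have the same rank. *)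
Lemma exc_rank n (w : av321 n) (i : 'I_n) : i <= w i ->
  exc_pos w i = exc_val w (w i).
Proof.
move=> ie; apply: eq_bigr => j _; case: (boolP (j <= w j)) => je; rewrite ?andbF //.
rewrite !andbT; congr nat_of_bool.
have [ji|ij|/val_inj->] := ltngtP j i.
- by rewrite (av321_mono ji) ?je ?ie.
- by have := @av321_mono _ w _ _ ij; rewrite je ie => /(_ erefl); case: ltngtP.
- by rewrite ltnn.
Qed.

Lemma nonexc_rank n (w : av321 n) (i : 'I_n) : w i < i ->
  i + exc_val w (w i) = w i + exc_pos w i.
Proof.
move=> ie.
have ien : (i <= w i) = false by rewrite leqNgt ie.
suff : \sum_(j < n) (j < i) + exc_val w (w i) = \sum_(j < n) (w j < w i) + exc_pos w i.
  by rewrite sum_ltn ?sum_perm_ltn // ltnW.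
rewrite -!big_split; apply: eq_bigr => j _ /=.
case: (boolP (j <= w j)) => je; rewrite ?andbF ?andbT /=; first by rewrite addnC.
congr (nat_of_bool _ + _).
have [ji|ij|/val_inj->] := ltngtP j i.
- by rewrite (av321_mono ji) ?(negbTE je) ?ien.
- by have := @av321_mono _ w _ _ ij; rewrite (negbTE je) ien => /(_ erefl); case: ltngtP.
- by rewrite ltnn.
Qed.

(** The counts give the weak excedances and their values, and the ranks tell which
    value belongs to which position. *)
Lemma exc_counts_inj n (w w' : av321 n) :
    (forall k, k <= n -> exc_pos w k = exc_pos w' k) ->
    (forall k, k <= n -> exc_val w k = exc_val w' k) -> w = w'.
Proof.
move=> ex ev; apply/val_inj/permP => i; apply: ord_inj.
have ei : (i <= w i) = (i <= w' i).
  have := exc_posS w i; have := exc_posS w' i; rewrite -!ex //; last exact: ltnW.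
  by case: (i <= w i); case: (i <= w' i) => //; lia.
wlog lt : w w' ex ev ei / w i < w' i.
  move=> H; have [lt|lt|//] := ltngtP (w i) (w' i); first exact: H.
  by apply/esym; apply: H => // k kn; rewrite ?ex ?ev.
have := exc_valS w i; have := exc_val_mono w lt; have := exc_valB w lt (ltnW (ltn_ord _)).
have := exc_val_mono w (leqnSn (w i)).
have wi := ltnW (ltn_ord (w' i)).
have [ie|ie] := leqP i (w i).
  have := exc_rank ie; have := @exc_rank _ w' i; rewrite -ei ie => /(_ isT).
  by rewrite -ex ?(ltnW (ltn_ord i)) // -ev //; lia.
have := nonexc_rank ie; have := @nonexc_rank _ w' i; rewrite ltnNge -ei -ltnNge ie => /(_ isT).
by rewrite -ex ?(ltnW (ltn_ord i)) // -ev //; lia.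
Qed.

(** * Permutations from their excedances *)

Definition cnt (P : pred nat) (k : nat) : nat := count P (iota 0 k).

Lemma cntS P k : cnt P k.+1 = cnt P k + P k.
Proof. by rewrite /cnt -addn1 iotaD count_cat /= addn0. Qed.

Lemma cnt_mono P a b : a <= b -> cnt P a <= cnt P b.
Proof. by move=> /subnKC <-; elim: (b - a) => [|d IH]; rewrite ?addn0 // addnS cntS; lia. Qed.

Lemma cntC P k : cnt P k + cnt (predC P) k = k.
Proof. by rewrite /cnt count_predC size_iota. Qed.

Lemma cnt_lt (P : pred nat) a b : P a -> a < b -> cnt P a < cnt P b.
Proof. by move=> Pa /(@cnt_mono P); rewrite cntS Pa; lia. Qed.

Lemma cnt_rank (P : pred nat) r k : r < cnt P k -> exists v, [/\ v < k, P v & cnt P v = r].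
Proof.
elim: k => // k IH; rewrite cntS; have [/IH[v [vk Pv e]] _|] := ltnP r (cnt P k).
  by exists v; split=> //; exact: leqW.
case: (boolP (P k)) => Pk; last by lia.
by move=> le lt; exists k; split=> //; lia.
Qed.

(** The permutation maps X to Y and the complement of X to the complement of Y,
    increasingly; the two inequalities place its values above and below the
    diagonal. *)
Lemma av321_of_sets n (X Y : pred nat) :
    cnt X n = cnt Y n -> (forall k, k <= n -> cnt Y k <= cnt X k) ->
    (forall k, k < n -> ~~ X k -> cnt Y k < cnt X k) ->
  exists w : av321 n, forall i : 'I_n, (i <= w i) = X i /\ X i = Y (w i).
Proof.
move=> tot leYX ltYX.
have [f Hf] : exists f : 'I_n -> 'I_n, forall i : 'I_n, X i = Y (f i) /\
    (if X i then cnt Y (f i) = cnt X i else cnt (predC Y) (f i) = cnt (predC X) i).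
  apply: (@fin_all_exists _ (fun=> 'I_n) (fun i v : 'I_n => X i = Y v /\
    (if X i then cnt Y v = cnt X i else cnt (predC Y) v = cnt (predC X) i))) => i.
  case: (boolP (X i)) => Xi.
    have [|v [vn Yv e]] := @cnt_rank Y (cnt X i) n; first by rewrite -tot cnt_lt.
    by exists (Ordinal vn).
  have [|v [vn Yv e]] := @cnt_rank (predC Y) (cnt (predC X) i) n.
    have := cntC X n; have := cntC Y n; have := @cnt_lt (predC X) i n Xi (ltn_ord i); lia.
  by exists (Ordinal vn); rewrite /= (negbTE Yv).
have mono (i j : 'I_n) : i < j -> X i = X j -> f i < f j.
  move=> ij eX; rewrite ltnNge; apply/negP => fji.
  have [_] := Hf i; have [_] := Hf j; rewrite -eX; case: (boolP (X i)) => Xi.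
    by have := cnt_mono Y fji; have := cnt_lt Xi ij; lia.
  by have := cnt_mono (predC Y) fji; have := @cnt_lt (predC X) _ _ Xi ij; lia.
have inj : injective f.
  move=> i j e; have eX : X i = X j by rewrite (Hf i).1 (Hf j).1 e.
  have [ij|ji|/val_inj//] := ltngtP i j.
    by have := mono _ _ ij eX; rewrite e ltnn.
  by have := mono _ _ ji (esym eX); rewrite e ltnn.
have exc (i : 'I_n) : (i <= f i) = X i.
  have [eXY] := Hf i; case: (boolP (X i)) eXY => Xi eXY e.
    apply/idP; rewrite leqNgt; apply/negP => fi; have := @cnt_lt Y (f i) i (esym eXY) fi.
    by have := leYX i (ltnW (ltn_ord i)); lia.
  apply/negbTE/negP => fi.
  have := ltYX i (ltn_ord i) Xi; have := cnt_mono (predC Y) fi; rewrite e.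
  by have := cntC X i; have := cntC Y i; lia.
have av : avoids321 (perm inj).
  apply/existsP => -[i /existsP[j /existsP[k /and4P[ij jk]]]].
  rewrite !permE => ji kj; have ik := ltn_trans ij jk.
  have := mono _ _ ij; have := mono _ _ jk; have := mono _ _ ik.
  case: (X i); case: (X j); case: (X k) => H1 H2 H3;
    first [move: (H1 erefl) | move: (H2 erefl) | move: (H3 erefl)];
    move: ji kj; clear; lia.
exists (Av321 av) => i /=; rewrite permE; split; first exact: exc.
exact: (Hf i).1.
Qed.

(** * The permutations of a Dyck path *)

Definition peaks_of n (w : av321 n) : seq (nat * nat) :=
  [seq (i : nat, (w i).+1) | i : 'I_n <- enum 'I_n & i <= w i].

Definition valleys_of n (w : av321 n) : seq (nat * nat) :=
  [seq ((w i).+1, i : nat) | i : 'I_n <- enum 'I_n & w i < i].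

Lemma sorted_filter_enum n (P : pred 'I_n) (f : 'I_n -> nat) :
    (forall i j, P i -> P j -> i < j -> f i < f j) ->
  sorted ltn [seq f i | i <- enum 'I_n & P i].
Proof.
move=> mono; rewrite sorted_map.
apply: (@sub_in_sorted _ P (fun i j => i < j)); first by move=> i j; exact: mono.
  exact: filter_all.
apply: sorted_filter; first by move=> x y z /=; exact: ltn_trans.
by have := iota_ltn_sorted 0 n; rewrite -val_enum_ord sorted_map.
Qed.

Lemma count_enum n (P : pred 'I_n) : count P (enum 'I_n) = \sum_(i < n) P i.
Proof. by rewrite -sum1_count big_mkcond big_enum /=; apply: eq_bigr => i _; case: (P i). Qed.

Section PathCounts.
Variables (n : nat) (w : av321 n).

Lemma count_peaks_of1 k :
  count (ltn^~ k) (unzip1 (peaks_of w)) = exc_pos w k.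
Proof. by rewrite /unzip1 -map_comp count_map count_filter count_enum. Qed.

Lemma count_peaks_of2 k :
  count (leq^~ k) (unzip2 (peaks_of w)) = exc_val w k.
Proof. by rewrite /unzip2 -map_comp count_map count_filter count_enum. Qed.

Lemma count_valleys_of1 k : k <= n ->
  count (leq^~ k) (unzip1 (valleys_of w)) + exc_val w k = k.
Proof.
move=> kn; rewrite -[RHS](sum_perm_ltn w kn) /unzip1 -map_comp count_map count_filter.
rewrite count_enum -big_split; apply: eq_bigr => i _ /=.
by rewrite (ltnNge (w i) i); case: (i <= w i); rewrite ?andbF ?andbT ?addn0.
Qed.

Lemma count_valleys_of2 k : k <= n ->
  count (ltn^~ k) (unzip2 (valleys_of w)) + exc_pos w k = k.
Proof.
move=> kn; rewrite -[RHS](sum_ltn kn) /unzip2 -map_comp count_map count_filter.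
rewrite count_enum -big_split; apply: eq_bigr => i _ /=.
by rewrite (ltnNge (w i) i); case: (i <= w i); rewrite ?andbF ?andbT ?addn0.
Qed.

End PathCounts.

Lemma cnt_mem (s : seq nat) k : uniq s -> cnt (mem s) k = count (ltn^~ k) s.
Proof.
move=> us; rewrite /cnt -!size_filter; apply/perm_size/uniq_perm; rewrite ?filter_uniq ?iota_uniq //.
by move=> x; rewrite !mem_filter mem_iota andbC.
Qed.

Lemma cnt_memS (s : seq nat) k : uniq s -> 0 \notin s ->
  cnt (fun v => v.+1 \in s) k = count (leq^~ k) s.
Proof.
move=> us s0; have := cnt_mem k.+1 us; rewrite /cnt /= (negbTE s0) add0n => <-.
by rewrite -[1]/(1 + 0) iotaDl count_map.
Qed.

Lemma leq_in_count (T : eqType) (a b : pred T) (s : seq T) :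
  {in s, forall x, a x -> b x} -> count a s <= count b s.
Proof.
move=> H; have -> : count a s = count (predI a b) s.
  by apply: eq_in_count => x /H /=; case: (a x) => // ->.
by apply: sub_count => x /andP[].
Qed.

Section PathPermutations.
Variables (n : nat) (D : dyck n).
Hypothesis n_gt0 : 0 < n.

Let xs := unzip1 (valleys D).
Let ys := unzip2 (valleys D).

Let px : unzip1 (peaks D) = 0 :: xs. Proof. by case: (dyck_corners D n_gt0). Qed.
Let py : unzip2 (peaks D) = rcons ys n. Proof. by case: (dyck_corners D n_gt0). Qed.

Let spx : sorted ltn (0 :: xs). Proof. by rewrite -px; case: (dyck_corners D n_gt0). Qed.
Let spy : sorted ltn (rcons ys n). Proof. by rewrite -py; case: (dyck_corners D n_gt0). Qed.

Let ltn_uniq s : sorted ltn s -> uniq s. Proof. exact: (sorted_uniq ltn_trans ltnn). Qed.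

Let xs0 : 0 \notin xs. Proof. by have /ltn_uniq/andP[] := spx. Qed.

Let ys_lt y : y \in ys -> y < n.
Proof.
by move: y; apply/allP; move: spy; rewrite (sorted_pairwise ltn_trans) pairwise_rcons => /andP[].
Qed.

Let mem_valley1 x : x \in xs -> exists2 y, y \in ys & x <= y.
Proof.
move=> /mapP[v vV ->]; exists v.2; first exact: map_f.
exact: valley_le vV.
Qed.

Let mem_valley2 y : y \in ys -> exists2 x, x \in xs & x <= y.
Proof.
move=> /mapP[v vV ->]; exists v.1; first exact: map_f.
exact: valley_le vV.
Qed.

Let count_valleys k : count (leq^~ k) ys <= count (leq^~ k) xs.
Proof.
rewrite /xs /ys /unzip1 /unzip2 (count_map snd) (count_map fst).
by apply: leq_in_count => v vV /=; exact: leq_trans (valley_le vV).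
Qed.

Let count_ys k : count (leq^~ k) (rcons ys n) = count (leq^~ k) ys + (n <= k).
Proof. by rewrite -cats1 count_cat /= addn0. Qed.

Let xs_lt x : x \in xs -> x < n.
Proof. by move=> /mem_valley1[y /ys_lt yn xy]; exact: leq_ltn_trans xy yn. Qed.

Let count_xs k : 0 < k -> count (ltn^~ k) (0 :: xs) = (count (ltn^~ k) xs).+1.
Proof. by rewrite /= => ->. Qed.

Let size_eq : size xs = size ys. Proof. by rewrite !size_map. Qed.

Let ltn_leqS (s : seq nat) k : k \notin s -> count (leq^~ k) s = count (ltn^~ k) s.
Proof.
move=> ks; apply: eq_in_count => x xs' /=; rewrite leq_eqVlt.
by case: eqP => // e; rewrite -e xs' in ks.
Qed.

Let count_n (s : seq nat) : (forall x, x \in s -> x < n) -> count (leq^~ n) s = size s.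
Proof. by move=> H; apply/eqP; rewrite -all_count; apply/allP => x /H /ltnW. Qed.

Let not_mem_n (s : seq nat) : (forall x, x \in s -> x < n) -> n \notin s.
Proof. by move=> H; apply/negP => /H; rewrite ltnn. Qed.

Let count_peaks k : count (leq^~ k) (rcons ys n) <= count (ltn^~ k) (0 :: xs).
Proof.
rewrite -px -py /unzip1 /unzip2 (count_map snd) (count_map fst).
by apply: leq_in_count => v vP /=; exact: leq_trans (peak_lt vP).
Qed.

Let y0 : 0 \notin rcons ys n.
Proof.
rewrite mem_rcons inE negb_or eq_sym -lt0n n_gt0 /=.
apply/negP => /mem_valley2[x xx]; rewrite leqn0 => /eqP e.
by rewrite e (negbTE xs0) in xx.
Qed.

(** A peak lies above the diagonal, which gives the first inequality of
    [av321_of_sets]; the next valley lies weakly above it, which gives the second. *)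
Lemma peaks_permutation : exists w : av321 n, peaks_of w = peaks D.
Proof.
have uy := ltn_uniq spy; have ux := ltn_uniq spx.
have [|k kn|k kn kx|w Hw] :=
    @av321_of_sets n (mem (0 :: xs)) (fun v => v.+1 \in rcons ys n).
- rewrite cnt_mem // cnt_memS // count_ys leqnn count_xs // -ltn_leqS ?not_mem_n //.
  by rewrite !count_n // size_eq addn1.
- by rewrite cnt_mem // cnt_memS.
- have k0 : 0 < k by move: kx; rewrite inE negb_or lt0n => /andP[].
  rewrite cnt_mem // cnt_memS // count_ys count_xs // (leqNgt n k) kn addn0 ltnS.
  rewrite -ltn_leqS //; by move: kx; rewrite inE negb_or => /andP[].
exists w; apply: eq_unzip; apply: sorted_ltn_eq; rewrite ?px ?py //.
- rewrite /unzip1 -map_comp; exact: sorted_filter_enum.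
- move=> x; apply/mapP/idP => [[v /mapP[i]]|xin].
    by rewrite mem_filter => /andP[ei _] -> ->; move: ei; rewrite (Hw i).1.
  have xn : x < n by move: xin; rewrite inE => /orP[/eqP -> //|/xs_lt].
  exists (x, (w (Ordinal xn)).+1) => //; apply/mapP; exists (Ordinal xn) => //.
  by rewrite mem_filter mem_enum (Hw _).1 /= xin.
- rewrite /unzip2 -map_comp; apply: sorted_filter_enum => i j ei ej ij /=.
  by rewrite ltnS av321_mono // ei ej.
- move=> y; apply/mapP/idP => [[v /mapP[i]]|yin].
    by rewrite mem_filter => /andP[ei _] -> ->; move: ei; rewrite (Hw i).1 (Hw i).2.
  have y1 : 0 < y by rewrite lt0n; apply: contraTneq yin => ->.
  have yn : y.-1 < n.
    by rewrite prednK //; move: yin; rewrite mem_rcons inE => /orP[/eqP -> //|/ys_lt/ltnW].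
  pose i := (av321_perm w)^-1%g (Ordinal yn); have wi : w i = y.-1 :> nat by rewrite permKV.
  exists (i : nat, y) => //; apply/mapP; exists i; last by rewrite wi prednK.
  by rewrite mem_filter mem_enum (Hw _).1 (Hw _).2 wi prednK // yin.
Qed.

(** The valleys lie weakly above the diagonal, so that the permutation maps their
    second coordinates to strictly smaller values. *)
Lemma valleys_permutation : exists w : av321 n, valleys_of w = valleys D.
Proof.
have sx : sorted ltn xs := path_sorted spx.
have sy : sorted ltn ys.
  by move: spy; rewrite !(sorted_pairwise ltn_trans) pairwise_rcons => /andP[].
have ux := ltn_uniq sx; have uy := ltn_uniq sy.
pose X := predC (mem ys); pose Y := predC (fun v => v.+1 \in xs).
have cX k : cnt X k + count (ltn^~ k) ys = k by rewrite addnC -cnt_mem // cntC.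
have cY k : cnt Y k + count (leq^~ k) xs = k by rewrite addnC -cnt_memS // cntC.
have [|k kn|k kn kx|w Hw] := @av321_of_sets n X Y.
- have := cX n; have := cY n; rewrite -ltn_leqS ?not_mem_n // !count_n // size_eq.
  by lia.
- have := cX k; have := cY k; have := count_valleys k.
  have : count (ltn^~ k) ys <= count (leq^~ k) ys by apply: sub_count => v /ltnW.
  by lia.
- have := cX k; have := cY k; have := count_valleys k.
  have : count (ltn^~ k) ys < count (leq^~ k) ys.
    have -> : count (leq^~ k) ys = count (predU (ltn^~ k) (pred1 k)) ys.
      by apply: eq_count => v /=; rewrite leq_eqVlt orbC.
    have := count_predUI (ltn^~ k) (pred1 k) ys.
    have : 0 < count (pred1 k) ys by rewrite -has_count has_pred1; move: kx; rewrite negbK.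
    rewrite (@eq_count _ (predI (ltn^~ k) (pred1 k)) pred0) ?count_pred0.
      by rewrite addn0 => c1 ->; rewrite -addn1 leq_add2l.
    by move=> v /=; case: eqP => [->|]; rewrite ?ltnn ?andbF.
  by lia.
have Hx (i : 'I_n) : (w i < i) = (nat_of_ord i \in ys) by rewrite ltnNge (Hw i).1 negbK.
have Hy (i : 'I_n) : (w i < i) = ((w i).+1 \in xs) by rewrite ltnNge (Hw i).1 (Hw i).2 negbK.
exists w; apply: eq_unzip; apply: sorted_ltn_eq => //.
- rewrite /unzip1 -map_comp; apply: sorted_filter_enum => i j ei ej ij /=.
  by rewrite ltnS av321_mono // (leqNgt i) (leqNgt j) ei ej.
- move=> x; apply/mapP/idP => [[v /mapP[i]]|xin].
    by rewrite mem_filter => /andP[ei _] -> ->; rewrite -Hy.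
  have x1 : 0 < x by rewrite lt0n; apply: contraTneq xin => ->.
  have xn : x.-1 < n by rewrite prednK //; exact/ltnW/xs_lt.
  pose i := (av321_perm w)^-1%g (Ordinal xn); have wi : w i = x.-1 :> nat by rewrite permKV.
  exists (x, i : nat) => //; apply/mapP; exists i; last by rewrite wi prednK.
  by rewrite mem_filter mem_enum Hy wi prednK // [_ \in _]xin.
- rewrite /unzip2 -map_comp; exact: sorted_filter_enum.
- move=> y; apply/mapP/idP => [[v /mapP[i]]|yin].
    by rewrite mem_filter => /andP[ei _] -> ->; rewrite -Hx.
  exists ((w (Ordinal (ys_lt yin))).+1, y) => //; apply/mapP.
  by exists (Ordinal (ys_lt yin)); rewrite // mem_filter mem_enum Hx yin.
Qed.

End PathPermutations.

(** * Robinson-Schensted insertion of a 321-avoiding permutation *)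

Lemma row_insert_last x T : all (leq^~ x) (nth [::] T 0) -> size T <= 2 ->
  exists T', [/\ row_insert x T = (T', 0), size T' <= 2,
    nth [::] T' 0 = rcons (nth [::] T 0) x & nth [::] T' 1 = nth [::] T 1].
Proof.
case: T => [|r T] /= xr sT; first by exists [:: [:: x]].
have /negbTE nh : ~~ has (fun y => x < y) r.
  by rewrite -all_predC; apply: sub_all xr => y /=; rewrite -leqNgt.
by rewrite -has_find nh; exists (rcons r x :: T).
Qed.

Lemma row_insert_bump x T (r := nth [::] T 0) (k := find (fun y => x < y) r) :
    has (fun y => x < y) r -> all (leq^~ (nth 0 r k)) (nth [::] T 1) -> size T <= 2 ->
  exists T', [/\ row_insert x T = (T', 1), size T' <= 2,
    nth [::] T' 0 = set_nth 0 r k x & nth [::] T' 1 = rcons (nth [::] T 1) (nth 0 r k)].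
Proof.
rewrite {}/k {}/r; case: T => [|r [|r2 [|]]] //= h all2 _.
  by rewrite -has_find h; exists [:: set_nth 0 r (find (fun y => x < y) r) x;
    [:: nth 0 r (find (fun y => x < y) r)]].
set u := nth 0 r _ in all2 *.
have /negbTE nh : ~~ has (fun y => u < y) r2.
  by rewrite -all_predC; apply: sub_all all2 => y /=; rewrite -leqNgt.
rewrite -!has_find h nh.
by exists [:: set_nth 0 r (find (fun y => x < y) r) x; rcons r2 u].
Qed.

Definition RS_prefix (s : seq nat) (k : nat) :=
  foldl RS_step ([::], [::]) (zip (iota 0 k) (take k s)).

Lemma RS_prefixS s k : k < size s ->
  RS_prefix s k.+1 = RS_step (RS_prefix s k) (k, nth 0 s k).
Proof.
move=> ks; rewrite /RS_prefix (take_nth 0 ks) -[in LHS](addn1 k) iotaD cats1.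
by rewrite zip_rcons ?foldl_rcons // size_iota size_takel // ltnW.
Qed.

Lemma RS_prefix_all s : RS s = RS_prefix s (size s).
Proof. by rewrite /RS_prefix take_size. Qed.

Section Insertion.
Variables (n : nat) (w : av321 n).
Implicit Types i j : 'I_n.

Definition word_of : seq nat := [seq w j : nat | j : 'I_n <- enum 'I_n].

Lemma size_word : size word_of = n.
Proof. by rewrite size_map size_enum_ord. Qed.

Lemma nth_word j : nth 0 word_of j = w j.
Proof. by rewrite (nth_map j) ?size_enum_ord // nth_ord_enum. Qed.

Definition row1 k := nth [::] (RS_prefix word_of k).1 0.
Definition row2 k := nth [::] (RS_prefix word_of k).1 1.
Definition rec2 k := nth [::] (RS_prefix word_of k).2 1.

Lemma mem_take_word k (v : nat) : k <= n ->
  reflect (exists2 j : 'I_n, j < k & v = w j :> nat) (v \in take k word_of).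
Proof.
move=> kn; apply: (iffP (nthP 0)); rewrite size_takel ?size_word //.
  case=> j jk; rewrite nth_take // => <-.
  by exists (Ordinal (leq_trans jk kn)); rewrite // -nth_word.
by case=> j jk ->; exists j; rewrite // nth_take // nth_word.
Qed.

(** A weak excedance exceeds all letters before it and bumps nothing.  Another
    letter can only bump a weak excedance.  Both kinds of letters come in
    increasing order, so the bumped entries increase, which is the last field, and
    nothing is bumped from the second row. *)
Record insertion_inv k : Prop := InsertionInv {
  inv_size : size (RS_prefix word_of k).1 <= 2;
  inv_sorted : sorted ltn (row1 k);
  inv_perm : perm_eq (row1 k ++ row2 k) (take k word_of);
  inv_exc : forall u, u \in row2 k ->
    exists2 j : 'I_n, u = w j :> nat & (j < k) && (j <= w j);
  inv_incr : forall u v, u \in row2 k -> v \in row1 k ->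
    (forall j, j < k -> w j < j -> w j < v) -> u < v }.

Definition insertion_step i : Prop :=
  [/\ row2 i.+1 = row2 i, rec2 i.+1 = rec2 i &
      i <= w i \/ (forall v, v \in row1 i -> v < w i)] \/
  exists u, [/\ w i < i, u \in row1 i, w i < u,
    (forall v, v \in row1 i -> w i < v -> u <= v) &
    row2 i.+1 = rcons (row2 i) u /\ rec2 i.+1 = rcons (rec2 i) i].

Lemma insertion_invP i : insertion_inv i -> insertion_inv i.+1 /\ insertion_step i.
Proof.
case=> sT srt prm exc incr.
have S := @RS_prefixS word_of i; rewrite size_word nth_word in S.
have {}S := S (ltn_ord i).
have row1_in (v : nat) : v \in row1 i -> exists2 j : 'I_n, j < i & v = w j :> nat.
  move=> vr; apply/mem_take_word; first exact: ltnW.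
  by rewrite -(perm_mem prm) mem_cat vr.
have tk : take i.+1 word_of = rcons (take i word_of) (w i).
  by rewrite (take_nth 0) ?size_word // nth_word.
have neq j : j < i -> w j <> w i :> nat.
  by move=> ji /val_inj/perm_inj e; rewrite e ltnn in ji.
case: (boolP (has (fun y => w i < y) (row1 i))) => hs; last first.
  have lt (v : nat) : v \in row1 i -> v < w i.
    move=> vr; rewrite ltnNge leq_eqVlt negb_or; apply/andP; split.
      by have [j ji ->] := row1_in v vr; rewrite eq_sym; apply/eqP/neq.
    by apply: contra hs => ltv; apply/hasP; exists v.
  have [|T' [eT sT' e1 e2]] := @row_insert_last (w i) (RS_prefix word_of i).1 _ sT.
    by apply/allP => v /lt/ltnW.
  have E1 : row1 i.+1 = rcons (row1 i) (w i) by rewrite /row1 S /RS_step eT e1.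
  have E2 : row2 i.+1 = row2 i by rewrite /row2 S /RS_step eT e2.
  have E3 : rec2 i.+1 = rec2 i.
    by rewrite /rec2 S /RS_step eT /= /add_cell nth_set_nth.
  split; last by left; split=> //; right.
  split; first by rewrite S /RS_step eT.
  - rewrite E1; move: srt; rewrite !(sorted_pairwise ltn_trans) pairwise_rcons => ->.
    by rewrite andbT; apply/allP => v /lt.
  - by rewrite E1 E2 tk -!cats1 perm_catAC perm_cat2r.
  - rewrite E2 => u /exc[j -> /andP[ji je]]; exists j; rewrite // je andbT; exact: ltnW.
  - rewrite E1 E2 => u v ur; rewrite mem_rcons inE => /orP[/eqP ->|vr] H; last first.
      by apply: incr => // j ji; apply: H; exact: ltnW.
    have [j -> /andP[ji je]] := exc u ur; apply: av321_mono => //.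
    by rewrite je leqNgt; apply/esym/negP => /(H i (leqnn _)); rewrite ltnn.
have Ni : w i < i.
  rewrite ltnNge; apply/negP => ie; case/hasP: hs => v /row1_in[j ji ->] ltj.
  have [je|je] := leqP j (w j).
    by have := @av321_mono _ w j i ji; rewrite ie je => /(_ erefl); lia.
  by lia.
have Nmono j : j < i -> w j < j -> w j < w i.
  by move=> ji je; apply: av321_mono => //; rewrite !(leqNgt _ (w _)) je Ni.
(* Cut the first row at the bumped entry u. *)
pose k := find (fun y => w i < y) (row1 i); pose u := nth 0 (row1 i) k.
have kr : k < size (row1 i) by rewrite -has_find.
have ltu : w i < u by exact: nth_find.
pose t := take k (row1 i); pose d := drop k.+1 (row1 i).
have rE : row1 i = t ++ u :: d by rewrite -drop_nth // cat_take_drop.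
have tlt (v : nat) : v \in t -> v < w i.
  move=> vt; have vr : v \in row1 i by rewrite rE mem_cat vt.
  have [j ji e] := row1_in v vr; rewrite ltn_neqAle e; apply/andP; split.
    by apply/eqP/neq.
  rewrite -e leqNgt; move: vt => /(nthP 0)[m]; rewrite size_take kr => mk <-.
  by rewrite nth_take // (before_find 0 mk).
have : pairwise ltn (row1 i) by rewrite -(sorted_pairwise ltn_trans).
rewrite rE pairwise_cat allrel_consr /= => /and3P[/andP[_ td] pt /andP[ud pd]].
have ltd (v : nat) : v \in d -> u < v by move: v; exact/allP.
have ur : u \in row1 i by rewrite rE mem_cat inE eqxx orbT.
have Eu : exists2 j : 'I_n, u = w j :> nat & (j < i) && (j <= w j).
  have [j ji e] := row1_in u ur; exists j; rewrite // ji leqNgt.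
  by apply/negP => /(Nmono j ji); rewrite -e; lia.
have lt2 (v : nat) : v \in row2 i -> v < u.
  by move=> vr; apply: incr => // j ji je; apply: ltn_trans ltu; exact: Nmono.
have [|T' [eT sT' e1 e2]] := @row_insert_bump (w i) (RS_prefix word_of i).1 hs _ sT.
  by apply/allP => v /lt2/ltnW.
have E1 : row1 i.+1 = t ++ (w i : nat) :: d.
  by rewrite /row1 S /RS_step eT e1 set_nthE kr.
have E2 : row2 i.+1 = rcons (row2 i) u by rewrite /row2 S /RS_step eT e2.
have E3 : rec2 i.+1 = rcons (rec2 i) i.
  by rewrite /rec2 S /RS_step eT /= /add_cell nth_set_nth.
split; last first.
  right; exists u; split=> // v; rewrite rE mem_cat inE => /or3P[/tlt|/eqP ->|/ltd/ltnW //] //.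
  by move=> a b; have := ltn_trans a b; rewrite ltnn.
split; first by rewrite S /RS_step eT.
- rewrite E1 (sorted_pairwise ltn_trans) pairwise_cat allrel_consr /= td pt pd !andbT.
  apply/andP; split; first by apply/allP => v /tlt.
  by apply/allP => v /ltd; exact: ltn_trans.
- rewrite E1 E2 tk; apply/seq.permP => a; have := seq.permP prm a.
  by rewrite rE -!cats1 !count_cat /=; lia.
- rewrite E2 => v; rewrite mem_rcons inE => /orP[/eqP ->|/exc[j -> /andP[ji je]]].
    by have [j -> /andP[ji je]] := Eu; exists j; rewrite // je andbT ltnW.
  by exists j; rewrite // je andbT ltnW.
- rewrite E1 E2 => u' v ur' vr H; have Hi := H i (leqnn _) Ni.
  move: vr; rewrite mem_cat inE => /or3P[/tlt lv|/eqP ev|vd].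
  + by have := ltn_trans Hi lv; rewrite ltnn.
  + by move: Hi; rewrite ev ltnn.
  move: ur'; rewrite mem_rcons inE => /orP[/eqP ->|ur2]; first exact: ltd.
  exact: ltn_trans (lt2 _ ur2) (ltd _ vd).
Qed.

Lemma insertion_invariant k : k <= n -> insertion_inv k.
Proof.
elim: k => [|k IH] kn.
  have E : RS_prefix word_of 0 = ([::], [::]) by rewrite /RS_prefix take0.
  by split; rewrite /row1 /row2 E ?take0.
by have [] := @insertion_invP (Ordinal kn) (IH (ltnW kn)).
Qed.

Lemma insertion_stepP i : insertion_step i.
Proof. by have [] := insertion_invP (insertion_invariant (ltnW (ltn_ord i))). Qed.
End Insertion.

(** * Bumps as a matching of parentheses *)

(** The number of unmatched opening parentheses among the first k places, when Y
    are the places of opening and U those of closing ones. *)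
Fixpoint scan (Y U : pred nat) (k : nat) : nat :=
  if k is k'.+1 then
    if Y k' then (scan Y U k').+1 else if U k' then (scan Y U k').-1 else scan Y U k'
  else 0.

Lemma eq_scan Y U Y' U' k :
    (forall v, v < k -> Y v = Y' v) -> (forall v, v < k -> U v = U' v) ->
  scan Y U k = scan Y' U' k.
Proof.
elim: k => //= k IH eY eU; rewrite eY ?eU // IH // => v vk; [apply: eY|apply: eU].
all: exact: ltnW.
Qed.

Lemma scan_le Y U k : scan Y U k <= cnt Y k.
Proof. by elim: k => //= k IH; rewrite cntS; case: (Y k); case: (U k); lia. Qed.

(** No opening parenthesis is closed, as no closing one follows the first of them. *)
Lemma scan_opening (Y U : pred nat) x k : (forall v, v < x -> ~~ Y v) ->
  (forall v, x <= v < k -> ~~ U v) -> scan Y U k = cnt Y k.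
Proof.
move=> Yx; elim: k => //= k IH Uk; rewrite cntS IH; last first.
  by move=> v /andP[xv vk]; apply: Uk; rewrite xv ltnW.
have [kx|xk] := ltnP k x; last first.
  by rewrite (negbTE (Uk k _)) ?xk //; case: (Y k); lia.
have -> : cnt Y k = 0.
  by apply/eqP; rewrite -leqn0 leqNgt -has_count; apply/hasPn => v; rewrite mem_iota => vk; apply: Yx; lia.
by rewrite (negbTE (Yx k kx)); case: (U k).
Qed.

Lemma cnt_remove (Y Y' : pred nat) x k :
  Y x -> (forall v, Y' v = (v != x) && Y v) -> cnt Y k = cnt Y' k + (x < k).
Proof.
move=> Yx H; elim: k => // k IH; rewrite !cntS IH H.
by have [->|] := eqVneq k x; rewrite ?Yx /=; lia.
Qed.

(** Removing the first opening parenthesis and the first closing one after it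
    changes the scan only between these places. *)
Lemma scan_remove (Y Y' U U' : pred nat) x u k :
    Y x -> (forall v, v < x -> ~~ Y v) -> (forall v, Y' v = (v != x) && Y v) ->
    U u -> x < u -> ~~ Y u -> (forall v, x <= v < u -> ~~ U v) ->
    (forall v, U' v = (v != u) && U v) ->
  u < k -> scan Y U k = scan Y' U' k.
Proof.
move=> Yx Yl Y'E Uu xu Yu Ul U'E.
elim: k => // k IH; rewrite ltnS leq_eqVlt => /orP[/eqP <-|uk] /=; last first.
  by rewrite Y'E U'E !IH // !gtn_eqF ?(ltn_trans xu).
rewrite Y'E U'E eqxx Uu (negbTE Yu) andbF /= (@scan_opening _ _ x) //.
rewrite (@scan_opening Y' U' x) ?(cnt_remove u Yx Y'E) ?xu ?addn1 //.
  by move=> v vx; rewrite Y'E negb_and Yl ?orbT.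
by move=> v vu; rewrite U'E negb_and Ul ?orbT.
Qed.

Section Dynamics.
Variables (n : nat) (w : av321 n).
Implicit Types i j : 'I_n.

Definition pos (v : nat) : nat := index v (word_of w).

Lemma pos_word j : pos (w j) = j.
Proof.
rewrite /pos -nth_word index_uniq ?size_word // map_inj_uniq ?enum_uniq //.
by move=> a b /val_inj/perm_inj.
Qed.

Lemma word_pos v : v < n -> exists2 j, v = w j :> nat & pos v = j.
Proof.
move=> vn; exists ((av321_perm w)^-1%g (Ordinal vn)); first by rewrite permKV.
by rewrite -pos_word permKV.
Qed.

Lemma pos_ge v : n <= v -> pos v = n.
Proof.
move=> nv; rewrite -(size_word w); apply: memNindex.
by apply/mapP => -[j _ e]; move: nv; rewrite e leqNgt ltn_ord.
Qed.

(** Once i letters are inserted, the values that wait for insertion and are not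
    values of weak excedances are opening parentheses, since they will bump; the
    weak excedances that can be bumped, those in the first row, are closing
    parentheses. *)
Definition waiting (i : nat) : pred nat := fun v => (i <= pos v) && (v < pos v).
Definition available (i : nat) : pred nat :=
  fun v => [&& pos v < i, pos v <= v & v \notin row2 w i].

(** In the non-crossing matching of positions and values that the two tableaux
    encode, this is the number of values below a that are not matched to one of
    the first i positions or first a values. *)
Definition open_vals (i a : nat) : nat :=
  scan (waiting i) (available i) a + count (leq a) (row2 w i).

Lemma row2_excP (i : nat) u : i <= n -> u \in row2 w i ->
  [/\ u < n, pos u < i & pos u <= u].
Proof.
move=> in_ /(inv_exc (insertion_invariant w in_))[j -> /andP[ji je]].
by rewrite pos_word.
Qed.

Lemma rows_uniq (i : nat) : i <= n -> uniq (row1 w i ++ row2 w i).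
Proof.
move=> in_; rewrite (perm_uniq (inv_perm (insertion_invariant w in_))) take_uniq //.
by rewrite map_inj_uniq ?enum_uniq // => a b /val_inj/perm_inj.
Qed.

Lemma mem_row1 (i v : nat) : i <= n -> (v \in row1 w i) = (pos v < i) && (v \notin row2 w i).
Proof.
move=> in_; have prm := inv_perm (insertion_invariant w in_).
have e : (v \in row1 w i) || (v \in row2 w i) = (pos v < i).
  rewrite -mem_cat (perm_mem prm); apply/(mem_take_word w _ in_)/idP => [[j ji ->]|].
    by rewrite pos_word.
  have [vn|nv] := ltnP v n; last by rewrite pos_ge // ltnNge in_.
  by have [j -> ->] := word_pos vn; exists j.
rewrite -e; have := rows_uniq in_; rewrite cat_uniq => /and3P[_ /hasPn H _].
by case: (boolP (v \in row2 w i)) => [/H/negbTE ->|]; rewrite ?andbF ?orbF ?andbT.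
Qed.

Lemma availableE (i v : nat) : i <= n -> available i v = (v \in row1 w i) && (pos v <= v).
Proof. by move=> in_; rewrite mem_row1 // /available -andbA; do 2!bool_congr; rewrite andbC. Qed.

Lemma cnt_word (P : pred nat) k : k <= n ->
  cnt P k = \sum_(j < n) ((w j < k) && P (w j)).
Proof.
elim: k => [|k IH] kn; first by rewrite big1.
rewrite cntS IH ?(ltnW kn) //; have [j0 e _] := word_pos kn.
have -> : nat_of_bool (P k) = \sum_(j < n) ((j == j0) && P (w j)).
  by rewrite (bigD1 j0) //= eqxx -e big1 ?addn0 // => j /negbTE ->.
rewrite -big_split; apply: eq_bigr => j _ /=; rewrite [in RHS]ltnS [w j <= k]leq_eqVlt.
have -> : (w j == k :> nat) = (j == j0) by rewrite e (inj_eq val_inj) (inj_eq perm_inj).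
by have [->|] := eqVneq j j0; rewrite ?addn0 // e ltnn.
Qed.

(** A value below i that is not inserted before time i belongs to no weak
    excedance, and there are as many such values as inserted values that are at
    least i; the latter are weak excedances. *)
Lemma cnt_waiting (i : nat) : i <= n -> cnt (waiting i) i + exc_val w i = exc_pos w i.
Proof.
move=> in_; rewrite cnt_word //.
suff : \sum_(j < n) ((w j < i) && waiting i (w j)) + exc_val w i + \sum_(j < n) (j < i)
    = exc_pos w i + \sum_(j < n) (w j < i).
  by rewrite sum_ltn // sum_perm_ltn //; lia.
rewrite -!big_split; apply: eq_bigr => j _ /=; rewrite /waiting pos_word.
by case: (ltnP (w j) i); case: (ltnP j i); case: (ltnP (w j) j) => //=; lia.
Qed.

(** The first two terms count the weak excedances inserted before time i whose
    value is at least i. *)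
Lemma count_row2 (i : nat) : i <= n ->
  count (leq i) (row2 w i) + \sum_(j < n) ((i <= w j) && available i (w j)) + exc_val w i
  = exc_pos w i.
Proof.
move=> in_; have -> : count (leq i) (row2 w i) = cnt (fun v => (i <= v) && (v \in row2 w i)) n.
  rewrite /cnt -!size_filter; apply/perm_size/uniq_perm.
  - by apply: filter_uniq; have := rows_uniq in_; rewrite cat_uniq => /and3P[].
  - by rewrite filter_uniq ?iota_uniq.
  move=> v; rewrite !mem_filter mem_iota -andbA /=; congr (_ && _).
  by apply/idP/andP => [vr|[]//]; have [] := row2_excP in_ vr.
rewrite cnt_word // -!big_split; apply: eq_bigr => j _ /=.
rewrite /available pos_word ltn_ord /=.
case: (boolP (_ \in _)) => [/(row2_excP in_)[_]|_]; rewrite ?pos_word.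
  by move=> ji je; rewrite ji je /=; case: (ltnP (w j) i) => //=; rewrite ?andbF.
by case: (ltnP (w j) i); case: (ltnP j i); case: (leqP j (w j)) => //=; lia.
Qed.

Lemma waitingS i v : waiting i.+1 v = (v != w i) && waiting i v.
Proof.
rewrite /waiting; have [vn|nv] := ltnP v n; last first.
  by rewrite pos_ge // [v < n]ltnNge nv !andbF.
have [j -> ->] := word_pos vn.
rewrite (inj_eq val_inj) (inj_eq perm_inj) -(inj_eq val_inj) ltn_neqAle.
by rewrite [_ == _ :> nat]eq_sym andbA.
Qed.

Lemma waiting_min i v : w i < i -> v < w i -> ~~ waiting i v.
Proof.
move=> Ni vi; apply/negP; rewrite /waiting.
have [vn|nv] := ltnP v n; last by have := ltn_ord (w i); lia.
have [j e ->] := word_pos vn; rewrite leq_eqVlt => /andP[/orP[/eqP/val_inj ij|ij] vj].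
  by move: vi; rewrite e ij ltnn.
have := @av321_mono _ w i j ij; rewrite -e (leqNgt i) (leqNgt j) Ni vj => /(_ erefl).
by rewrite ltnNge ltnW.
Qed.

Lemma nonexc_avail i v : w i < i ->
  available i.+1 v = (pos v < i) && (pos v <= v) && (v \notin row2 w i.+1).
Proof.
move=> Ni; rewrite /available ltnS leq_eqVlt -andbA; case: eqP => //= e.
rewrite ltn_neqAle e eqxx /=.
have [vn|nv] := ltnP v n; last by move: e; rewrite pos_ge // => e; have := ltn_ord i; lia.
have [j ev pj] := word_pos vn; have ji : j = i by apply: val_inj; rewrite -[LHS]pj.
by rewrite ev ji leqNgt Ni.
Qed.

Lemma row2_sub i : {subset row2 w i <= row2 w i.+1}.
Proof.
move=> v vr; have [[-> _ _]//|[u [_ _ _ _ [-> _]]]] := insertion_stepP w i.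
by rewrite mem_rcons inE vr orbT.
Qed.

Lemma row2_excS i : i <= w i -> row2 w i.+1 = row2 w i.
Proof.
move=> ie; have [[-> _ _]//|[u [lt]]] := insertion_stepP w i.
by rewrite ltnNge ie in lt.
Qed.

Lemma scan_exc i k : i <= w i -> k <= w i ->
  scan (waiting i.+1) (available i.+1) k = scan (waiting i) (available i) k.
Proof.
move=> ie kw; have vk v : v < k -> v < w i by move/leq_trans; apply.
apply: eq_scan => v /vk lt; first by rewrite waitingS ltn_eqF.
rewrite /available row2_excS // ltnS leq_eqVlt; case: eqP => // e.
have vn : v < n by exact: ltn_trans lt (ltn_ord _).
have [j ev pj] := word_pos vn; have ji : j = i by apply: val_inj; rewrite -[LHS]pj.
by move: lt; rewrite ev ji ltnn.
Qed.

Lemma avail_row1 i v : w i < i -> available i.+1 v ->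
  [/\ v \in row1 w i, v <> w i & v \notin row2 w i.+1].
Proof.
move=> Ni; rewrite nonexc_avail // => /andP[/andP[vi ve] vr]; split=> //.
  rewrite mem_row1 ?vi; last exact: ltnW.
  by apply: contra vr; exact: row2_sub.
by move=> e; move: vi; rewrite e pos_word ltnn.
Qed.

Lemma avail_row1_neq i v : available i v -> v \in row1 w i /\ v <> w i.
Proof.
move=> av; have := av; rewrite availableE; last exact: ltnW.
case/andP => vr _; split=> // e.
by move: av; rewrite /available e pos_word ltnn.
Qed.

(** As long as no closing parenthesis follows the inserted value, its removal
    lowers the scan. *)
Lemma scan_nonexc_opening i k : w i < i -> w i < k ->
    (forall v, v \in row1 w i -> w i < v -> k <= v) ->
  scan (waiting i) (available i) k = cnt (waiting i) k /\
  scan (waiting i) (available i) k = (scan (waiting i.+1) (available i.+1) k).+1.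
Proof.
move=> Ni wk H; have Wx : waiting i (w i) by rewrite /waiting pos_word leqnn Ni.
have -> : scan (waiting i) (available i) k = cnt (waiting i) k.
  apply: (@scan_opening _ _ (w i)) => [v|v /andP[xv vk]]; first exact: waiting_min.
  apply/negP => /avail_row1_neq[vr /eqP ne].
  by have := H v vr; rewrite ltn_neqAle eq_sym ne xv leqNgt vk => /(_ isT).
split=> //; rewrite (cnt_remove k Wx (waitingS i)) wk addn1; congr _.+1; symmetry.
apply: (@scan_opening _ _ (w i)) => [v vx|v /andP[xv vk]].
  by rewrite waitingS negb_and waiting_min ?orbT.
apply/negP => /(avail_row1 Ni)[vr /eqP ne _].
by have := H v vr; rewrite ltn_neqAle eq_sym ne xv leqNgt vk => /(_ isT).
Qed.

(** The parenthesis of a bumped value is removed with that of the value that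
    bumps it. *)
Lemma scan_nonexc_bump i u k : w i < i -> u \in row1 w i -> w i < u ->
    (forall v, v \in row1 w i -> w i < v -> u <= v) ->
    row2 w i.+1 = rcons (row2 w i) u -> u < k ->
  scan (waiting i) (available i) k = scan (waiting i.+1) (available i.+1) k /\
  scan (waiting i) (available i) k < cnt (waiting i) k.
Proof.
move=> Ni ur wu H e uk; have Wx : waiting i (w i) by rewrite /waiting pos_word leqnn Ni.
have in_ : i <= n by exact: ltnW.
have [un _ ue] : [/\ u < n, pos u < i.+1 & pos u <= u].
  by apply: row2_excP; rewrite ?e ?mem_rcons ?inE ?eqxx.
have pu : pos u < i by move: ur; rewrite mem_row1 // => /andP[].
suff E : scan (waiting i) (available i) k = scan (waiting i.+1) (available i.+1) k.
  split=> //; rewrite E (cnt_remove k Wx (waitingS i)) (ltn_trans wu uk) addn1 ltnS.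
  exact: scan_le.
apply: (@scan_remove _ _ _ _ (w i) u) => //.
- by move=> v; exact: waiting_min.
- exact: waitingS.
- by rewrite availableE // ur.
- by rewrite /waiting leqNgt pu.
- move=> v /andP[xv vu]; apply/negP => /avail_row1_neq[vr /eqP ne].
  by have := H v vr; rewrite ltn_neqAle eq_sym ne xv leqNgt vu => /(_ isT).
- move=> v; rewrite nonexc_avail // e mem_rcons inE negb_or /available -!andbA.
  by case: (v != u); rewrite ?andbF.
Qed.

(** A weak excedance leaves the open values unchanged.  A bump does so as well,
    and needs an open position; without a bump, all open ends are values and the
    position is matched to one of them. *)
Lemma open_vals_pos i :
  [\/ [/\ i <= w i, open_vals i.+1 i = open_vals i i & size (row2 w i.+1) = size (row2 w i)],
      [/\ w i < i, open_vals i.+1 i = open_vals i i,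
         open_vals i i + (exc_val w i).*2 < (exc_pos w i).*2
       & size (row2 w i.+1) = (size (row2 w i)).+1]
    | [/\ w i < i, open_vals i i = (open_vals i.+1 i).+1,
         open_vals i i + (exc_val w i).*2 = (exc_pos w i).*2
       & size (row2 w i.+1) = size (row2 w i)]].
Proof.
have in_ : i <= n by exact: ltnW.
have cw := cnt_waiting in_; have cr := count_row2 in_.
have sl := scan_le (waiting i) (available i) i.
have [ie|Ni] := leqP i (w i).
  by apply: Or31; rewrite /open_vals scan_exc // row2_excS.
have [[e _ [|H]]|[u [_ ur wu H [e _]]]] := insertion_stepP w i.
- by rewrite leqNgt Ni.
- have [|s1 s2] := scan_nonexc_opening Ni Ni.
    by move=> v /H vx /ltn_trans/(_ vx); rewrite ltnn.
  apply: Or33; split; rewrite ?e //; first by rewrite /open_vals e; lia.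
  rewrite /open_vals s1; move: cr; rewrite big1; first by lia.
  move=> j _; case: (boolP (available i (w j))); rewrite ?andbF //.
  by case/avail_row1_neq => /H lt _; rewrite andbT leqNgt (ltn_trans lt Ni).
apply: Or32; have [iu|ui] := leqP i u.
  have [|s1 s2] := scan_nonexc_opening Ni Ni.
    by move=> v vr /(H v vr); exact: leq_trans.
  rewrite /open_vals e size_rcons -cats1 count_cat /= iu; split=> //; first by lia.
  have [un _ ue] : [/\ u < n, pos u < i.+1 & pos u <= u].
    by apply: row2_excP; rewrite ?e ?mem_rcons ?inE ?eqxx.
  have [j ej _] := word_pos un; move: cr.
  rewrite (bigD1 j) //= -ej iu availableE // ur ue /=; lia.
have [s1 s2] := scan_nonexc_bump Ni ur wu H e ui.
rewrite /open_vals e size_rcons -cats1 count_cat /= (leqNgt i u) ui s1 !addn0; split=> //.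
by lia.
Qed.

(** At any time after its insertion, this tells whether a weak excedance v is ever
    bumped: if it still stands in the first row, it will be bumped exactly when
    one of the waiting values below it finds no other partner. *)
Definition bumpable (i v : nat) : bool :=
  (v \in row2 w i) || (0 < scan (waiting i) (available i) v).

Lemma bumpableS i v : pos v < i -> pos v <= v -> bumpable i.+1 v = bumpable i v.
Proof.
move=> vi ve; have in_ : i <= n by exact: ltnW.
have vn : v < n by rewrite ltnNge; apply/negP => /pos_ge e; move: vi; rewrite e; lia.
have [j ev pj] := word_pos vn; rewrite pj ev in vi ve.
have vw : v <> w i by rewrite ev => /val_inj/perm_inj e; rewrite e ltnn in vi.
rewrite /bumpable; have [ie|Ni] := leqP i (w i).
  rewrite row2_excS // scan_exc // ev ltnW // av321_mono //.
  by rewrite ve ie.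
case: (boolP (v \in row2 w i)) => [/row2_sub -> //|vr2] /=.
have vr : v \in row1 w i by rewrite mem_row1 // pj vi.
have scan0 Y U : (forall z, z < w i -> ~~ Y z) -> v < w i -> scan Y U v = 0.
  move=> HY vx; rewrite (@scan_opening _ _ v).
  - apply/eqP; rewrite -leqn0 leqNgt -has_count; apply/hasPn => z; rewrite mem_iota => zv.
    by apply: HY; lia.
  - by move=> z zv; apply: HY; exact: ltn_trans zv vx.
  - by move=> z; lia.
have W z : z < w i -> ~~ waiting i z by exact: waiting_min.
have W' z : z < w i -> ~~ waiting i.+1 z by move=> /W; rewrite waitingS; case: waiting; rewrite ?andbF.
have [[e _ [|H]]|[u [_ ur wu H [e _]]]] := insertion_stepP w i.
- by rewrite leqNgt Ni.
- by rewrite e (negbTE vr2) !scan0 // H.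
have [vx|xv] := ltnP v (w i).
  rewrite !scan0 // e mem_rcons inE (negbTE vr2) ltnn !orbF; apply/negbTE/eqP => vu.
  by move: (ltn_trans vx wu); rewrite vu ltnn.
have {}xv : w i < v by rewrite ltn_neqAle xv andbT eq_sym; exact/eqP.
have [uv|vu] := eqVneq u v.
  have [|-> _] := scan_nonexc_opening Ni xv; first by rewrite -uv.
  rewrite e mem_rcons inE uv eqxx /= -has_count; symmetry; apply/hasP.
  by exists (w i : nat); rewrite ?mem_iota // /waiting pos_word leqnn.
have [|-> _] := scan_nonexc_bump Ni ur wu H e (_ : u < v).
  by rewrite ltn_neqAle vu H.
by rewrite e mem_rcons inE [v == u]eq_sym (negbTE vu) (negbTE vr2).
Qed.

Lemma bumpable_final (i v : nat) : i <= n -> pos v < i -> pos v <= v ->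
  bumpable i v = (v \in row2 w n).
Proof.
move=> in_ vi ve.
have -> : (v \in row2 w n) = bumpable n v.
  rewrite /bumpable; suff -> : scan (waiting n) (available n) v = 0 by rewrite orbF.
  apply/eqP; rewrite -leqn0; apply: leq_trans (scan_le _ _ _) _.
  rewrite leqNgt -has_count; apply/hasPn => z _; rewrite /waiting.
  have [zn|nz] := ltnP z n; last by rewrite pos_ge // ltnNge nz andbF.
  by have [j _ ->] := word_pos zn; rewrite leqNgt ltn_ord.
suff H d : i + d <= n -> bumpable (i + d) v = bumpable i v.
  by rewrite -(H (n - i)) subnKC.
elim: d => [|d IH] idn; first by rewrite addn0.
rewrite addnS in idn *; rewrite -IH ?(ltnW idn) // -(@bumpableS (Ordinal idn) v) //.
exact: leq_trans vi (leq_addr _ _).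
Qed.

(** A value that belongs to no weak excedance becomes open.  The value of a weak
    excedance is matched to an open value if there is one, and then it is bumped
    at some time; otherwise it is matched to a position. *)
Lemma open_vals_val i :
  [\/ [/\ i < pos i, open_vals i.+1 i.+1 = (open_vals i.+1 i).+1 & (i : nat) \notin row2 w n],
      [/\ pos i <= i, open_vals i.+1 i = (open_vals i.+1 i.+1).+1 & (i : nat) \in row2 w n]
    | [/\ pos i <= i, open_vals i.+1 i = 0, open_vals i.+1 i.+1 = 0
       & (i : nat) \notin row2 w n]].
Proof.
have in1 : i.+1 <= n by exact: ltn_ord.
have cnt_split : count (leq i) (row2 w i.+1) =
    count (leq i.+1) (row2 w i.+1) + ((i : nat) \in row2 w i.+1).
  have := rows_uniq in1; rewrite cat_uniq => /and3P[_ _] u2.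
  rewrite -(count_uniq_mem _ u2); elim: (row2 w i.+1) => //= v s ->.
  by case: (ltngtP i v) => /= _; rewrite ?add0n ?add1n ?addnS.
have [ip|pi] := ltnP i (pos i).
  have nr k : k <= n -> (i : nat) \notin row2 w k.
    by move=> kn; apply/negP => /(row2_excP kn)[_ _]; rewrite leqNgt ip.
  apply: Or31; split; rewrite ?nr // /open_vals cnt_split (negbTE (nr _ in1)) addn0 /=.
  by rewrite {1}/waiting ip.
have Wi : waiting i.+1 i = false by rewrite /waiting leqNgt ltnS pi.
have pi' : pos i < i.+1 by [].
have := bumpable_final in1 pi' pi; rewrite /bumpable.
case: (boolP ((i : nat) \in row2 w i.+1)) => [ir fin|ir fin].
  apply: Or32; split; rewrite -?fin // /open_vals cnt_split ir /= Wi.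
  by rewrite /available ir !andbF; lia.
have Ai : available i.+1 i by rewrite /available pi' pi ir.
have cnt_same : count (leq i) (row2 w i.+1) = count (leq i.+1) (row2 w i.+1).
  by rewrite cnt_split (negbTE ir) addn0.
move: fin => /=; case: posnP => [s0 fin|s0 fin]; last first.
  by apply: Or32; split; rewrite -?fin // /open_vals cnt_same /= Wi Ai; lia.
have c0 : count (leq i) (row2 w i.+1) = 0.
  apply/eqP; rewrite -leqn0 leqNgt -has_count; apply/hasPn => u ur; rewrite -ltnNge.
  apply: (inv_incr (insertion_invariant w in1)) => //.
    by rewrite mem_row1 // ir pi'.
  by move=> j ji je; apply: leq_trans je _.
by apply: Or33; split; rewrite -?fin // /open_vals -?cnt_same c0 /= ?Wi ?Ai s0.
Qed.

End Dynamics.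

(** * The zigzag of the Robinson-Schensted word *)

(** Here nu and o count the open ends on either side of the interval, and tau the
    arcs that join the two sides.  Going back along the zigzag, the interval grows
    by one height, which is at least tau; and when tau drops, this height is equal
    to tau, as its side has no open end. *)
Lemma zigzag_rmin n (h nu o tau : nat -> nat) :
    (forall k, k <= n.*2 ->
       h k./2 = nu k + tau k /\ h (n.*2 - uphalf k) = o k + tau k) ->
    (forall k, k < n.*2 -> tau k.+1 = tau k \/
       tau k.+1 = (tau k).+1 /\ (if odd k then nu k else o k) = 0) ->
    nu n.*2 = 0 ->
  forall k, k <= n.*2 -> rmin h k./2 (n.*2 - uphalf k - k./2) = tau k.
Proof.
move=> H T nu0 k kn; rewrite -(subKn kn); move: (leq_subr k n.*2).
elim: (n.*2 - k) => [|d IH] dn {k kn}.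
  have [h1 _] := H _ (leqnn _); rewrite subn0 uphalf_double doubleK.
  by move: h1; rewrite doubleK nu0 -addnn !addnK subnn.
have {}IH := IH (ltnW dn); set k := n.*2 - d.+1.
have kS : n.*2 - d = k.+1 by rewrite /k; lia.
have kn : k < n.*2 by rewrite /k; lia.
rewrite kS in IH; have [h1 h2] := H k (ltnW kn).
have := T k kn; have := odd_double_half k; clearbody k.
case: (boolP (odd k)) => ok kE Tk.
  have -> : n.*2 - uphalf k - k./2 = (n.*2 - uphalf k.+1 - k.+1./2).+1.
    by rewrite !uphalfE /=; lia.
  rewrite rmin_left; have -> : k./2.+1 = k.+1./2 by lia.
  by rewrite IH h1; lia.
have -> : n.*2 - uphalf k - k./2 = (n.*2 - uphalf k.+1 - k./2).+1.
  by rewrite !uphalfE /=; lia.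
rewrite /=; have -> : k./2 + (n.*2 - uphalf k.+1 - k./2).+1 = n.*2 - uphalf k.
  by rewrite !uphalfE /=; lia.
have e : k.+1./2 = k./2 by lia.
by rewrite e in IH; rewrite IH h2; lia.
Qed.

Section RSKWord.
Variables (n : nat) (w : av321 n).
Implicit Types i : 'I_n.

Lemma nth_RSK_word m : m < n.*2 -> nth false (RSK_word w) m =
  if m < n then m \in row1 w n else n.*2 - m.+1 \in rec2 w n.
Proof.
move=> mn; rewrite /RSK_word /RS_perm -/(word_of w) RS_prefix_all size_word.
rewrite /row1 /rec2; case: (RS_prefix _ _) => A B.
by rewrite -[m]/(nat_of_ord (Ordinal mn)) -tnth_nth tnth_mktuple.
Qed.

Lemma ups_RSK_left a : a <= n -> ups (RSK_word w) a + cnt (mem (row2 w n)) a = a.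
Proof.
elim: a => [|a IH] an; first by rewrite /ups take0.
have a2 : a < n.*2 by lia.
rewrite upsS ?size_tuple // nth_RSK_word // an cntS mem_row1 //.
have [j _ pj] := word_pos w an; rewrite pj ltn_ord /=.
have := IH (ltnW an); case: (a \in row2 w n) => /=; lia.
Qed.

Lemma rec2_lt (k m : nat) : k <= n -> m \in rec2 w k -> m < k.
Proof.
elim: k m => [|k IH] m kn; first by rewrite /rec2 /RS_prefix take0.
have [[_ -> _]|[u [_ _ _ _ [_ ->]]]] := insertion_stepP w (Ordinal kn).
  by move=> /(IH _ (ltnW kn)); exact: ltnW.
rewrite mem_rcons inE => /orP[/eqP -> //|/(IH _ (ltnW kn))]; exact: ltnW.
Qed.

Lemma size_row2S i : size (row2 w i.+1) = size (row2 w i) + ((i : nat) \in rec2 w n).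
Proof.
have -> : ((i : nat) \in rec2 w n) = ((i : nat) \in rec2 w i.+1).
  suff H d : i.+1 + d <= n -> ((i : nat) \in rec2 w (i.+1 + d)) = ((i : nat) \in rec2 w i.+1).
    by rewrite -(H (n - i.+1)) subnKC.
  elim: d => [|d IH] dn; first by rewrite addn0.
  rewrite addnS in dn *; rewrite -IH ?(ltnW dn) //.
  have [[_ -> _]|[u [_ _ _ _ [_ ->]]]] := insertion_stepP w (Ordinal dn) => //.
  by rewrite mem_rcons inE ltn_eqF //= addSn ltnS leq_addr.
have ni : (i : nat) \notin rec2 w i.
  by apply/negP => /(rec2_lt (ltnW (ltn_ord i))); rewrite ltnn.
have [[-> -> _]|[u [_ _ _ _ [-> ->]]]] := insertion_stepP w i.
  by rewrite (negbTE ni) addn0.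
by rewrite size_rcons mem_rcons inE eqxx addn1.
Qed.

Lemma cnt_row2_all : cnt (mem (row2 w n)) n = size (row2 w n).
Proof.
have := rows_uniq w (leqnn n); rewrite cat_uniq => /and3P[_ _ u2].
rewrite cnt_mem //; apply/eqP; rewrite -all_count; apply/allP => u.
by case/(row2_excP (leqnn n)).
Qed.

Lemma ups_RSK_right p : p <= n -> ups (RSK_word w) (n.*2 - p) + size (row2 w p) = n.
Proof.
move=> pn; rewrite -(subKn pn); move: (leq_subr p n).
elim: (n - p) => [|d IH] dn {p pn}.
  by rewrite subn0 (_ : n.*2 - n = n) -?cnt_row2_all ?ups_RSK_left //; lia.
have in_ : n - d.+1 < n by lia.
have := IH (ltnW dn); have := size_row2S (Ordinal in_).
rewrite [nat_of_ord _]/=; set i := n - d.+1 in in_ *.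
have -> : n - d = i.+1 by rewrite /i; lia.
have iN : n.*2 - i.+1 < n.*2 by lia.
have := @upsS (RSK_word w) (n.*2 - i.+1); rewrite size_tuple => /(_ iN).
rewrite nth_RSK_word // ltnNge (_ : n <= n.*2 - i.+1); last by lia.
rewrite (_ : (n.*2 - i.+1).+1 = n.*2 - i) /=; last by lia.
rewrite (_ : n.*2 - (n.*2 - i) = i); last by lia.
lia.
Qed.

(** After k steps of the zigzag, [uphalf k] positions and [k./2] values are read.
    They have [zig_vals k] open values and [zig_pos k] open positions, and
    [zig_arcs k] arcs join a position to a value; the other arcs join two
    positions or two values, and are counted by the second rows. *)
Definition zig_vals k := open_vals w (uphalf k) k./2.
Definition zig_arcs k := k./2 - zig_vals k - (cnt (mem (row2 w n)) k./2).*2.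
Definition zig_pos k := uphalf k - zig_arcs k - (size (row2 w (uphalf k))).*2.

Definition zig_inv k : Prop :=
  [/\ k./2 = zig_vals k + zig_arcs k + (cnt (mem (row2 w n)) k./2).*2,
      uphalf k = zig_pos k + zig_arcs k + (size (row2 w (uphalf k))).*2
    & zig_vals k + zig_pos k + (exc_val w k./2).*2 + odd k =
      (exc_pos w (uphalf k)).*2].

Definition zig_step k : Prop :=
  zig_arcs k.+1 = zig_arcs k \/
  zig_arcs k.+1 = (zig_arcs k).+1 /\ (if odd k then zig_vals k else zig_pos k) = 0.

Lemma zig_even i : zig_inv i.*2 -> zig_inv i.*2.+1 /\ zig_step i.*2.
Proof.
rewrite /zig_inv /zig_step /zig_pos /zig_arcs /zig_vals /= !uphalf_double !doubleK.
rewrite odd_double /= addn0; case=> e1 e2 e3; have := exc_posS w i.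
move: e1 e2 e3; have := open_vals_pos w i.
move: (open_vals w i i) (open_vals w i.+1 i) (cnt _ _) (size (row2 w i)) => v v' c s.
move: (size (row2 w i.+1)) (exc_val w i) (exc_pos w i) (exc_pos w i.+1) => s' y x x'.
case=> -[wi]; move: wi; case: (leqP i (w i)) => //= _ _ -> //; clear;
  move=> *; (split; first split); lia.
Qed.

Lemma zig_odd i : zig_inv i.*2.+1 -> zig_inv i.+1.*2 /\ zig_step i.*2.+1.
Proof.
rewrite doubleS /zig_inv /zig_step /zig_pos /zig_arcs /zig_vals /= !uphalf_double !doubleK.
rewrite odd_double /= addn0 cntS; case=> e1 e2 e3.
have ev : exc_val w i.+1 = exc_val w i + (pos w i <= i).
  by have [j -> ->] := word_pos w (ltn_ord i); exact: exc_valS.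
have := ev; move: e1 e2 e3; have := open_vals_val w i.
move: (open_vals w i.+1 i) (open_vals w i.+1 i.+1) (cnt _ _) (size (row2 w i.+1)) => v v' c s.
move: (exc_val w i) (exc_val w i.+1) (exc_pos w i.+1) => y y' x {ev}.
rewrite -[mem _ _]/((i : nat) \in row2 w n).
case=> -[]; case: (leqP (pos w i) i) => //= _ _; case: (_ \in _) => //; clear;
  move=> *; (split; first split); lia.
Qed.

Lemma zig_invP k : k <= n.*2 -> zig_inv k.
Proof.
elim: k => [|k IH] kn.
  by split; rewrite /zig_pos /zig_arcs /zig_vals /open_vals /row2 /RS_prefix take0 //=
    exc_val0 exc_pos0.
have {}IH := IH (ltnW kn); have k2 : k./2 < n by lia.
have := odd_double_half k; case: (odd k) => kE; rewrite -kE in IH *.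
  by have [] := @zig_odd (Ordinal k2) IH.
by have [] := @zig_even (Ordinal k2) IH.
Qed.

Lemma zig_stepP k : k < n.*2 -> zig_step k.
Proof.
move=> kn; have := zig_invP (ltnW kn); have k2 : k./2 < n by lia.
have := odd_double_half k; case: (odd k) => kE; rewrite -kE => IH.
  by have [] := @zig_odd (Ordinal k2) IH.
by have [] := @zig_even (Ordinal k2) IH.
Qed.

Lemma RSK_word_is_dyck : is_dyck n (RSK_word w).
Proof.
apply/is_dyckP; split; first by rewrite size_tuple.
  by have := ups_RSK_right (leq0n n); rewrite subn0 /row2 /RS_prefix take0 addn0.
move=> k kn; have [kn'|nk] := leqP k n.
  have := ups_RSK_left kn'; have := @zig_invP k.*2.
  by rewrite leq_double => /(_ kn')[]; rewrite doubleK; lia.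
have pn : n.*2 - k <= n by lia.
have := ups_RSK_right pn; rewrite (_ : n.*2 - (n.*2 - k) = k); last by lia.
have := @zig_invP (n.*2 - k).*2; rewrite leq_double => /(_ pn)[_].
by rewrite uphalf_double; lia.
Qed.

Definition RSK_dyck : dyck n := Dyck RSK_word_is_dyck.

(** The arcs that leave the part already read are its open values and positions,
    by [zigzag_rmin]; each step changes their total by 1 or -1, according to the
    kind of the position or value. *)
Lemma zigzag_RSK : zigzag (exc_pos w) (exc_val w) RSK_dyck.
Proof.
have H k : k <= n.*2 -> ht RSK_dyck k./2 = zig_vals k + zig_arcs k /\
    ht RSK_dyck (n.*2 - uphalf k) = zig_pos k + zig_arcs k.
  move=> kn; have [e1 e2 _] := zig_invP kn; have k2 : k./2 <= n by lia.
  have k2' : uphalf k <= n by rewrite uphalfE; lia.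
  have := ups_RSK_left k2; have := ups_RSK_right k2'.
  rewrite /ht -[dyck_word RSK_dyck]/(RSK_word w).
  move: (ups _ _) (ups _ _) => u u'; split; lia.
have V : zig_vals n.*2 = 0.
  have [_ _] := zig_invP (leqnn n.*2); rewrite uphalf_double doubleK odd_double exc_total; lia.
have cutE k : k <= n.*2 -> cut (ht RSK_dyck) k./2 (n.*2 - uphalf k) = zig_vals k + zig_pos k.
  move=> kn; rewrite /cut (zigzag_rmin H zig_stepP V kn).
  by have [-> ->] := H k kn; lia.
move=> i in_; have e1 : i.*2 <= n.*2 by rewrite leq_double ltnW.
have e2 : i.*2.+1 <= n.*2 by lia.
have := cutE _ e1; have := cutE _ e2.
rewrite /= uphalf_double !doubleK => -> ->.
have [_ _] := zig_invP e1; have [_ _] := zig_invP e2.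
by rewrite /= uphalf_double !doubleK odd_double /=; lia.
Qed.

End RSKWord.

(** * The Lalanne-Kreweras map *)

Lemma the_spec (A : finType) (x0 : A) (Q : pred A) : (exists x, Q x) -> Q (the x0 Q).
Proof.
rewrite /the; case: pickP => [x //|Q0 [x Qx]].
by rewrite Q0 in Qx.
Qed.

Lemma inverse_inj (A B : finType) (x0 : A) (f : A -> B) :
  injective f -> cancel f (inverse x0 f).
Proof.
move=> inj x; apply: inj; apply/eqP.
by apply: (@the_spec _ _ (fun y => f y == f x)); exists x.
Qed.

(** The zigzag of the word gives the counts of weak excedances. *)
Lemma RSK_dyck_inj n : injective (@RSK_dyck n).
Proof.
move=> w w' e; have z := zigzag_RSK w; have z' := zigzag_RSK w'; rewrite -e in z'.
suff H k : k <= n -> exc_pos w k = exc_pos w' k /\ exc_val w k = exc_val w' k.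
  by apply: exc_counts_inj => k /H[].
elim: k => [|k IH] kn; first by rewrite !exc_pos0 !exc_val0.
have [x y] := IH (ltnW kn).
have [_ z1] := z k kn; have [_ z1'] := z' k kn.
have xS : exc_pos w k.+1 = exc_pos w' k.+1 by lia.
split=> //; have [kn1|nk] := ltnP k.+1 n.
  by have [z2 _] := z _ kn1; have [z2' _] := z' _ kn1; lia.
have kE : k.+1 = n by lia.
by move: xS; rewrite kE !exc_total.
Qed.

(** An injection from Dyck paths to 321-avoiding permutations is onto, because the
    tableaux give an injection in the other direction. *)
Lemma path_exists n (w : av321 n) : 0 < n ->
  (exists D : dyck n, peaks D = peaks_of w) /\
  (exists D : dyck n, valleys D = valleys_of w).
Proof.
move=> n0; have card := leq_card _ (@RSK_dyck_inj n); split.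
  have [f fP] := fin_all_exists (fun D => @peaks_permutation n D n0).
  have inj : injective f.
    by move=> D D' e; apply: peaks_inj => //; rewrite -!fP e.
  by have [g _ gK] := inj_card_bij inj card; exists (g w); rewrite -fP gK.
have [f fP] := fin_all_exists (fun D => @valleys_permutation n D n0).
have inj : injective f.
  by move=> D D' e; apply: valleys_inj => //; rewrite -!fP e.
by have [g _ gK] := inj_card_bij inj card; exists (g w); rewrite -fP gK.
Qed.

Section LK.
Variable n : nat.
Hypothesis n_gt0 : 0 < n.

Lemma peaks_path_p (w : av321 n) : perm_eq (peaks (path_p w)) (peaks_of w).
Proof.
apply: (@the_spec _ _ (fun D : dyck n => perm_eq (peaks D) (peaks_of w))).
by have [[D e] _] := path_exists w n_gt0; exists D; rewrite e.
Qed.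

Lemma valleys_path_q (w : av321 n) : perm_eq (valleys (path_q w)) (valleys_of w).
Proof.
apply: (@the_spec _ _ (fun D : dyck n => perm_eq (valleys D) (valleys_of w))).
by have [_ [D e]] := path_exists w n_gt0; exists D; rewrite e.
Qed.

Lemma path_p_invK : cancel (@path_p_inv n) (@path_p n).
Proof.
move=> D; apply/eqP; apply: (@the_spec _ _ (fun w : av321 n => path_p w == D)).
have [w wP] := peaks_permutation D n_gt0; exists w; apply/eqP/peaks_inj => //.
by rewrite -wP; exact: peaks_path_p.
Qed.

Lemma RSK_hatE (D : dyck n) : RSK_hat D = RSK_dyck (path_p_inv D).
Proof.
by apply: val_inj; rewrite /RSK_hat val_insubd RSK_word_is_dyck.
Qed.

Lemma RSK_hat_inj : injective (@RSK_hat n).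
Proof.
move=> D D'; rewrite !RSK_hatE => /RSK_dyck_inj.
exact: (can_inj path_p_invK).
Qed.

(** The valleys of the path Dyck2 D are the positions and values of w that are not
    weak excedances, its peaks the weak excedances of w'; peaks and valleys have
    the same coordinates, up to 0 and n. *)
Lemma exc_Dyck2 (D : dyck n) i (w := path_p_inv D) (w' := path_p_inv (Dyck2 D)) :
    i < n ->
  exc_pos w i.+1 + exc_val w' i = i.+1 /\ exc_val w i + exc_pos w' i.+1 = i.+1.
Proof.
move=> in_; have V := valleys_path_q w; rewrite -/(Dyck2 D) in V.
have := peaks_path_p w'; rewrite path_p_invK => P.
have [_ px py _ _] := dyck_corners (Dyck2 D) n_gt0.
have cP1 k : exc_pos w' k = count (ltn^~ k) (0 :: unzip1 (valleys_of w)).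
  rewrite -count_peaks_of1; have /seq.permP <- := perm_map fst P; rewrite -/(unzip1 _) px.
  by rewrite /=; have /seq.permP -> := perm_map fst V.
have cP2 k : exc_val w' k = count (leq^~ k) (rcons (unzip2 (valleys_of w)) n).
  rewrite -count_peaks_of2; have /seq.permP <- := perm_map snd P; rewrite -/(unzip2 _) py.
  by rewrite -!cats1 !count_cat; have /seq.permP -> := perm_map snd V.
rewrite cP1 cP2 -cats1 count_cat /= (leqNgt n) in_ !addn0; split.
  by rewrite addnC; exact: count_valleys_of2.
by rewrite addnC add1n addSn; congr _.+1; exact: count_valleys_of1 (ltnW in_).
Qed.

Lemma RSK_hat_Dyck2 (D X : dyck n) : RSK_hat D = promotion X ->
  RSK_hat (Dyck2 D) = evacuation X.
Proof.
move=> e; rewrite RSK_hatE; apply: zigzag_inj (zigzag_RSK _) _.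
apply: (@zigzag_evacuation _ (exc_pos (path_p_inv D)) (exc_val (path_p_inv D))).
- exact: exc_pos0.
- exact: exc_val0.
- by move=> i; apply: exc_val_mono.
- by move=> i; exact: exc_Dyck2.
by rewrite -e RSK_hatE; exact: zigzag_RSK.
Qed.

End LK.

Theorem proposition6p13 (n : nat) (hn : 0 < n) :
  [/\ corresponds (@Kre n) (@promotion n),
      @Rot n =1 @Kre n \o @Kre n
        /\ corresponds (@Rot n) (@promotion n \o @promotion n),
      corresponds (@SU n) (@evacuation n \o @promotion n)
    & corresponds (@LK n) (@evacuation n \o finv (@promotion n))].
Proof.
have thetaK : cancel (@theta n) (@theta_inv n) by apply/inverse_inj/theta_inj.
split.
- by move=> P /=; rewrite -theta_Kre.
- split=> P /=; first exact: Rot_Kre.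
  by rewrite -!theta_Kre // thetaK Rot_Kre.
- by move=> P /=; rewrite -theta_SU.
move=> P; rewrite /LK /=; congr theta_inv; apply: RSK_hat_Dyck2 => //.
by rewrite !f_finv //; [exact: promotion_inj | exact: RSK_hat_inj].
Qed.
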